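(* Suppose $\widetilde{\bm f}_h^{n+1}=\bm 0$ for all $n$, and let $J=1$. Then the scheme (AC) described in the context satisfies the modified discrete energy law $$\mathscr{E}^N+\tau\sum_{k=1}^N\mathscr{P}^k\le C\qquad\text{for all } N\ge1 \text{ (with } N\tau\le T),$$ where $C$ is a constant depending only on the initial data and the dimensionless numbers (see the context), and $$\mathscr{E}^n=\|(\widetilde{\sigma}\bm{u})_h^n\|^2+\frac{\mathrm{Cn}}{\mathrm{We}}\|\nabla\phi_h^n\|^2+\frac{s}{\mathrm{We}\,\mathrm{Cn}}\|\phi_h^n\|^2+\frac{2}{\mathrm{We}\,\mathrm{Cn}}|R^n|^2+|Q^n|^2+\zeta\|\nabla\cdot\bm{u}_h^n\|^2+\frac{\tau^2}{\varrho}\|P_h^n\|^2,$$ $$\mathscr{P}^n=\frac{4}{\mathrm{Re}}\|(\eta_h^{n-1})^{1/2}\mathbb{D}(\bm{u}_h^n)\|^2+\frac{2}{T}|Q^n|^2+\frac{2}{\mathrm{Pe}\,\mathrm{We}\,\mathrm{Cn}}\|\nabla\mu_h^n\|^2.$$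
   Context: Domain and spaces. $\Omega\subset\mathbb{R}^d$ ($d=2,3$) is a bounded connected Lipschitz domain; $(\cdot,\cdot)$, $\|\cdot\|$ are the $L^2(\Omega)$ inner product and norm, $\|\cdot\|_1$ the $H^1(\Omega)$ norm. On a quasi-uniform triangulation of mesh size $h$ let $V_h\subset H^1(\Omega)$, $\bm X_h\subset H^1_0(\Omega)^d$, $N_h\subset H^1(\Omega)$ be conforming (continuous piecewise polynomial, finite dimensional) finite element spaces, $M_h=N_h\cap L^2_0(\Omega)$, with the inf-sup condition $\inf_{0\ne q\in M_h}\sup_{0\ne\bm v\in\bm X_h}\frac{(\nabla\cdot\bm v,q)}{\|\bm v\|_1\|q\|}\ge C_0>0$, $C_0$ independent of $h$. Parameters. $\mathrm{Cn},\mathrm{Pe},\mathrm{Re},\mathrm{We},\mathrm{Fr}>0$ (dimensionless numbers), $\rho_1,\rho_2,\eta_1,\eta_2,\rho_r,\eta_r>0$, $s,S>0$, final time $T>0$, uniform time step $\tau$ ($T/\tau$ a positive integer), $t^n=n\tau$; $\varrho=\min(\rho_1,\rho_2)/\rho_r$ and $\zeta\ge3\varrho$ is fixed. $F(\phi)=\frac14(\phi^2-1)^2$, $G(\phi)=F(\phi)-\frac s2\phi^2$; $S$ is such that $\int_\Omega G(\phi)\,\mathrm{d}\bm x+S>0$ for all relevant $\phi$. The mobility is constant, normalized to $m=1$. Time notation for $J=1$, for a generic quantity $\chi$: $\gamma_0=1$, $\delta_\tau\chi^{n+1}=(\chi^{n+1}-\chi^n)/\tau$, extrapolation $\widetilde\chi^{n+1}=\chi^n$,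 and $\mathscr D\chi^{n+1}=\chi^{n+1}-\chi^n$. Coefficients. $\widetilde\phi_h^{n+1}=\phi_h^n$, $\widetilde\mu_h^{n+1}=\mu_h^n$, $\widetilde{\bm u}_h^{n+1}=\bm u_h^n$. With the cut-off $\phi^{\mathscr C}=\phi$ if $|\phi|\le1$ and $\phi^{\mathscr C}=\mathrm{sign}(\phi)$ otherwise, set $\rho(\phi)=\frac{\rho_1-\rho_2}{2\rho_r}\phi^{\mathscr C}+\frac{\rho_1+\rho_2}{2\rho_r}$, $\eta(\phi)=\frac{\eta_1-\eta_2}{2\eta_r}\phi^{\mathscr C}+\frac{\eta_1+\eta_2}{2\eta_r}$, $\sigma=\sqrt\rho$, $U(\phi)=\sqrt{\int_\Omega G(\phi)\,\mathrm{d}\bm x+S}$, and $\widetilde\rho_h^{n+1}=\rho(\widetilde\phi_h^{n+1})$, $\widetilde\eta_h^{n+1}=\eta(\widetilde\phi_h^{n+1})$ (so $\widetilde\eta_h^{n+1}=\eta_h^n:=\eta(\phi_h^n)$), $\widetilde\sigma_h^{n+1}=\sigma(\widetilde\phi_h^{n+1})$, $\widetilde U^{n+1}=U(\widetilde\phi_h^{n+1})$, $\widetilde{\bm J}_h^{n+1}=-\frac{\rho_1-\rho_2}{2\rho_r\mathrm{Pe}}\nabla\widetilde\mu_h^{n+1}$; $(\widetilde\sigma\bm u)_h^n=\widetilde\sigma_h^n\bm u_h^n$ with $\widetilde\sigma_h^0=\sigma(\phi_h^0)$. $\mathbb D(\bm u)=\frac12(\nabla\bm u+\nabla\bm u^T)$;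 $\widetilde{\bm f}_h^{n+1}\in L^2(\Omega)^d$ is the gravity force evaluated at $\widetilde\rho_h^{n+1}$. Further $\xi_1^{n+1}=R^{n+1}/\widetilde U^{n+1}$, $\xi_2^{n+1}=e^{t^{n+1}/T}Q^{n+1}$. Write $\widetilde{\bm w}=\widetilde\rho_h^{n+1}\widetilde{\bm u}_h^{n+1}+\widetilde{\bm J}_h^{n+1}$ and $\mathcal B^{n+1}(\bm v)=(\widetilde{\bm w}\cdot\nabla\widetilde{\bm u}_h^{n+1},\bm v)-(\widetilde{\bm w}\cdot\nabla\bm v,\widetilde{\bm u}_h^{n+1})$, where $(\bm w\cdot\nabla\bm u)_i=\sum_j w_j\partial_ju_i$. Scheme (AC) with $J=1$: for $n\ge0$, $(\phi_h^{n+1},\mu_h^{n+1})\in V_h\times V_h$, $\bm u_h^{n+1}\in\bm X_h$, $P_h^{n+1}\in N_h$, $R^{n+1},Q^{n+1}\in\mathbb R$ satisfy, for all $(\psi_h,\omega_h)\in V_h\times V_h$, $\bm v_h\in\bm X_h$, $q_h\in N_h$: (i) $(\delta_\tau\phi_h^{n+1},\omega_h)=\xi_1^{n+1}(\widetilde\phi_h^{n+1}\widetilde{\bm u}_h^{n+1},\nabla\omega_h)-\frac1{\mathrm{Pe}}(\nabla\mu_h^{n+1},\nabla\omega_h)$; (ii) $(\mu_h^{n+1},\psi_h)=\mathrm{Cn}^2(\nabla\phi_h^{n+1},\nabla\psi_h)+s(\phi_h^{n+1},\psi_h)+\xi_1^{n+1}(G'(\widetilde\phi_h^{n+1}),\psi_h)$;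 (iii) $\delta_\tau R^{n+1}=\frac1{2\widetilde U^{n+1}}\big((G'(\widetilde\phi_h^{n+1}),\delta_\tau\phi_h^{n+1})-(\widetilde\phi_h^{n+1}\widetilde{\bm u}_h^{n+1},\nabla\mu_h^{n+1})+(\widetilde\phi_h^{n+1}\nabla\widetilde\mu_h^{n+1},\bm u_h^{n+1})\big)$; (iv) $(\widetilde\sigma_h^{n+1}\delta_\tau(\widetilde\sigma\bm u)_h^{n+1},\bm v_h)+\zeta(\nabla\cdot\delta_\tau\bm u_h^{n+1},\nabla\cdot\bm v_h)+\frac2{\mathrm{Re}}(\widetilde\eta_h^{n+1}\mathbb D(\bm u_h^{n+1}),\mathbb D(\bm v_h))=-\frac{\xi_2^{n+1}}2\mathcal B^{n+1}(\bm v_h)+(P_h^\sharp,\nabla\cdot\bm v_h)-\frac{\xi_1^{n+1}}{\mathrm{We}\,\mathrm{Cn}}(\widetilde\phi_h^{n+1}\nabla\widetilde\mu_h^{n+1},\bm v_h)+\frac1{\mathrm{Fr}}(\widetilde{\bm f}_h^{n+1},\bm v_h)$; (v) $(\mathscr DP_h^{n+1},q_h)=-\frac{\gamma_0\varrho}\tau(\nabla\cdot\bm u_h^{n+1},q_h)$; (vi) $\delta_\tau Q^{n+1}=-\frac{Q^{n+1}}T+\frac12e^{t^{n+1}/T}\mathcal B^{n+1}(\bm u_h^{n+1})$, where $P_h^\sharp=2P_h^n-P_h^{n-1}$ for $n\ge1$ and $P_h^\sharp=P_h^0$ for $n=0$. Initial data: $\phi_h^0,\mu_h^0\in V_h$,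 $\bm u_h^0\in\bm X_h$, $P_h^0\in N_h$, $R^0=\sqrt{\int_\Omega G(\phi^0)\,\mathrm{d}\bm x+S}$ ($\phi^0$ the initial order parameter), $Q^0=1$. ''Depending only on the initial data and the dimensionless numbers'' means that $C$ may depend on these initial data, the dimensionless numbers and the fixed parameters listed above ($\rho_i,\eta_i,\rho_r,\eta_r,s,S,\zeta,T$), but not on $\tau$ or $N$. *)

(* Defs.v *)
From HB Require Import structures.
From mathcomp Require Import all_boot all_order all_algebra.
From mathcomp Require Import all_classical all_reals all_analysis.

Set Implicit Arguments.
Unset Strict Implicit.
Unset Printing Implicit Defensive.
Import Order.TTheory GRing.Theory Num.Theory.
Import numFieldNormedType.Exports.
Local Open Scope classical_set_scope.
Local Open Scope ring_scope.

(* The library has no measurable structure on ['rV[R]_n]; this one is the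
   sigma-algebra generated by the coordinates, i.e. the Borel one. *)
Section measurable_rV.
Context {R : realType} (n : nat).

Let coor (i : 'I_n) (x : 'rV[R]_n) : R := x ord0 i.

Let rV_set0 : g_sigma_preimage coor set0.
Proof. exact: sigma_algebra0. Qed.

Let rV_setC A : g_sigma_preimage coor A -> g_sigma_preimage coor (~` A).
Proof. exact: sigma_algebraC. Qed.

Let rV_bigcup (F : (set 'rV[R]_n)^nat) :
  (forall i, g_sigma_preimage coor (F i)) ->
  g_sigma_preimage coor (\bigcup_i (F i)).
Proof. exact: sigma_algebra_bigcup. Qed.

HB.instance Definition _ := @isMeasurable.Build default_measure_display
  'rV[R]_n (g_sigma_preimage coor) rV_set0 rV_setC rV_bigcup.

Lemma measurable_coord (i : 'I_n) :
  measurable_fun [set: 'rV[R]_n] (fun x : 'rV[R]_n => x ord0 i).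
Proof.
move=> _ Y mY; rewrite setTI; apply: sub_sigma_algebra => /=.
rewrite -bigcup_seq/=; exists i => /=; first by rewrite mem_index_enum.
by exists Y => //; rewrite setTI.
Qed.

Lemma measurable_fun_rVP d (T : measurableType d) (f : T -> 'rV[R]_n) :
  (forall i, measurable_fun [set: T] (fun x => f x ord0 i)) ->
  measurable_fun [set: T] f.
Proof.
move=> mf; suff prefS : g_sigma_preimage (fun i => coor i \o f) `<=` measurable.
  move: prefS; rewrite g_sigma_preimage_comp => prefS _ A mA.
  by apply: prefS; exists A.
apply: smallest_sub; first exact: sigma_algebra_measurable.
rewrite -bigcup_seq; apply: bigcup_sub => i _ A [B mB <-].
exact: mf.
Qed.

End measurable_rV.

(* [lebesgue_rV n] is n-dimensional Lebesgue measure: the iterated product of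
   [lebesgue_measure], transported along R x R^n ~ R^(n+1). *)
Section lebesgue_rV.
Context {R : realType}.
Local Open Scope ereal_scope.

Definition consrV n (p : R * 'rV[R]_n) : 'rV[R]_n.+1 :=
  row_mx (const_mx p.1 : 'rV_1) p.2.

Let unconsrV n (x : 'rV[R]_n.+1) : R * 'rV[R]_n :=
  (x ord0 ord0, @rsubmx R 1 1 n x).

Let consrVK n : cancel (@consrV n) (@unconsrV n).
Proof.
case=> a x; congr pair; last exact: row_mxKr.
rewrite (_ : ord0 = lshift n (ord0 : 'I_1)); last exact/val_inj.
by rewrite (@row_mxEl _ 1 1 n) mxE.
Qed.

Lemma measurable_consrV n : measurable_fun [set: R * 'rV[R]_n] (@consrV n).
Proof.
apply: measurable_fun_rVP => i.
case: (@split_ordP 1 n i) => j ->.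
  rewrite (_ : (fun _ => _) = fst); first exact: measurable_fst.
  by apply/funext => x; rewrite (@row_mxEl _ 1 1 n) mxE.
rewrite (_ : (fun _ => _) = (fun y : 'rV_n => y ord0 j) \o snd).
  by apply: measurableT_comp; [exact: measurable_coord|exact: measurable_snd].
by apply/funext => x; rewrite (@row_mxEr _ 1 1 n).
Qed.

Let measurable_unconsrV n : measurable_fun [set: 'rV[R]_n.+1] (@unconsrV n).
Proof.
apply/measurable_fun_pairP; split; first exact: (measurable_coord ord0).
apply: measurable_fun_rVP => i.
rewrite (_ : (fun _ => _) = (fun y : 'rV_n.+1 => y ord0 (rshift 1 i))).
  exact: measurable_coord.
by apply/funext => x /=; rewrite mxE.
Qed.

Section step.
Variables (n : nat) (m : {sigma_finite_measure set 'rV[R]_n -> \bar R}).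

Definition lebesgue_step : set 'rV[R]_n.+1 -> \bar R :=
  pushforward (lebesgue_measure \x m) (@consrV n).

Let step0 : lebesgue_step set0 = 0.
Proof. by rewrite /lebesgue_step /pushforward preimage_set0 measure0. Qed.

Let step_ge0 A : 0 <= lebesgue_step A.
Proof. by rewrite /lebesgue_step /pushforward measure_ge0. Qed.

Let step_sigma_additive : semi_sigma_additive lebesgue_step.
Proof.
have mc B : measurable B -> measurable (@consrV n @^-1` B).
  by move=> mB; rewrite -[X in measurable X]setTI; exact: measurable_consrV.
move=> F mF tF mUF; rewrite /lebesgue_step /pushforward preimage_bigcup.
apply: measure_semi_sigma_additive.
- by move=> k; exact: mc.
- apply/trivIsetP => /= i j _ _ ij; rewrite -preimage_setI.
  by move/trivIsetP : tF => /(_ _ _ _ _ ij) ->//; rewrite preimage_set0.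
- by rewrite -preimage_bigcup; exact: mc.
Qed.

HB.instance Definition _ := isMeasure.Build _ _ _ lebesgue_step
  step0 step_ge0 step_sigma_additive.

Let step_sigma_finite : sigma_finite setT lebesgue_step.
Proof.
have /sigma_finiteP[F [TF ndF Foo]] := sigma_finiteT (@lebesgue_measure R).
have /sigma_finiteP[G [TG ndG Goo]] := sigma_finiteT m.
exists (fun k => @unconsrV n @^-1` (F k `*` G k)).
  rewrite -preimage_bigcup (_ : \bigcup_k _ = setT) ?preimage_setT//.
  rewrite -setXTT TF TG predeqE => -[x y]; split.
    by move=> [k _ []/= ? ?]; split; exists k.
  move=> [/= [k _ Fkx] [l _ Gly]]; exists (maxn k l) => //; split.
  - by move: x Fkx; exact/subsetPset/ndF/leq_maxl.
  - by move: y Gly; exact/subsetPset/ndG/leq_maxr.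
move=> k; have [mF Foo'] := Foo k; have [mG Goo'] := Goo k; split.
  rewrite -[X in measurable X]setTI; apply: measurable_unconsrV => //.
  exact: measurableX.
rewrite /lebesgue_step /pushforward.
rewrite (_ : _ @^-1` _ = F k `*` G k).
  by rewrite product_measure1E// lte_mul_pinfty// ge0_fin_numE.
by apply/funext => p; rewrite -[in RHS](consrVK p).
Qed.

HB.instance Definition _ := Measure_isSigmaFinite.Build _ _ _ lebesgue_step
  step_sigma_finite.

End step.

Fixpoint lebesgue_rV (n : nat) : {sigma_finite_measure set 'rV[R]_n -> \bar R} :=
  match n with
  | 0 => dirac (0%R : 'rV[R]_0)
  | m.+1 => lebesgue_step (lebesgue_rV m)
  end.

End lebesgue_rV.

Section sobolev.
Context {R : realType} (d : nat).
Local Notation Rd := 'rV[R]_d.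
Local Notation leb := (@lebesgue_rV R d).
Implicit Types (Omega : set Rd) (u v g : Rd -> R).

Definition sq_integrable Omega u :=
  measurable_fun Omega u /\ leb.-integrable Omega (fun x => (u x ^+ 2)%:E).

Definition ip Omega u v : R := \int[leb]_(x in Omega) (u x * v x).

Definition l2norm Omega u : R := Num.sqrt (ip Omega u u).

(* L^2 product and norm of matrix-valued functions, for the Frobenius product;
   vector fields are the row case. *)
Definition ipm Omega m n (F H : Rd -> 'M[R]_(m, n)) : R :=
  \int[leb]_(x in Omega) (\sum_i \sum_j F x i j * H x i j).

Definition l2normm Omega m n (F : Rd -> 'M[R]_(m, n)) : R :=
  Num.sqrt (ipm Omega F F).

Definition partial (i : 'I_d) u : Rd -> R := fun x => 'D_(delta_mx ord0 i) u x.

Definition iter_partial (s : seq 'I_d) u : Rd -> R := foldr partial u s.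

Definition smooth u := forall s : seq 'I_d,
  continuous (iter_partial s u) /\
  forall (i : 'I_d) x, derivable (iter_partial s u) x (delta_mx ord0 i).

Definition test_function Omega u :=
  [/\ smooth u, compact (closure [set x | u x != 0]) &
      closure [set x | u x != 0] `<=` Omega].

Definition weak_partial Omega (i : 'I_d) u g :=
  forall t, test_function Omega t ->
    \int[leb]_(x in Omega) (u x * partial i t x) =
    - \int[leb]_(x in Omega) (g x * t x).

Definition H1 Omega u := sq_integrable Omega u /\
  forall i : 'I_d, exists g, sq_integrable Omega g /\ weak_partial Omega i u g.

(* A representative of the weak derivative, which is unique up to a.e. equality
   when [u] is in H^1; junk value 0 otherwise. *)
Definition wD Omega (i : 'I_d) u : Rd -> R :=
  xget (fun=> 0) [set g | sq_integrable Omega g /\ weak_partial Omega i u g].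

Definition grad Omega u : Rd -> Rd := fun x => \row_i wD Omega i u x.

Definition H1norm Omega u : R :=
  Num.sqrt (l2norm Omega u ^+ 2 + l2normm Omega (grad Omega u) ^+ 2).

Definition H10 Omega u := H1 Omega u /\
  forall e : R, 0 < e ->
    exists t, test_function Omega t /\ H1norm Omega (u - t) < e.

Definition vcomp (w : Rd -> Rd) (i : 'I_d) : Rd -> R := fun x => w x ord0 i.

Definition jac Omega (w : Rd -> Rd) : Rd -> 'M[R]_d :=
  fun x => \matrix_(i, j) wD Omega j (vcomp w i) x.

Definition H1normv Omega (w : Rd -> Rd) : R :=
  Num.sqrt (l2normm Omega w ^+ 2 + l2normm Omega (jac Omega w) ^+ 2).

Definition diver Omega (w : Rd -> Rd) : Rd -> R :=
  fun x => \sum_i wD Omega i (vcomp w i) x.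

Definition symgrad Omega (w : Rd -> Rd) : Rd -> 'M[R]_d :=
  fun x => 2^-1 *: (jac Omega w x + (jac Omega w x)^T).

Definition advect Omega (w u : Rd -> Rd) : Rd -> Rd :=
  fun x => \row_i \sum_j w x ord0 j * wD Omega j (vcomp u i) x.

End sobolev.

Section geometry.
Context {R : realType} (d : nat).
Local Notation Rd := 'rV[R]_d.

Definition dotp (x y : Rd) : R := \sum_i x ord0 i * y ord0 i.

(* Euclidean norm: [`|x|] on ['rV_d] is the max norm. *)
Definition enorm (x : Rd) : R := Num.sqrt (dotp x x).

(* Near every boundary point, Omega lies strictly above the graph, in the
   direction of a unit vector [e], of a Lipschitz function on the hyperplane
   orthogonal to [e] (extended to R^d and evaluated at the projection). *)
Definition lipschitz_boundary (Omega : set Rd) :=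
  forall x, closure Omega x -> ~ Omega x ->
  exists (e : Rd) (gamma : Rd -> R) (L r : R),
    [/\ enorm e = 1, 0 < r,
        forall y z, `|gamma y - gamma z| <= L * enorm (y - z) &
        forall y, enorm (y - x) < r ->
          (Omega y <-> gamma (y - dotp y e *: e) < dotp y e)].

Definition lipschitz_domain (Omega : set Rd) :=
  [/\ Omega !=set0, open Omega, connected Omega, bounded_set Omega &
      lipschitz_boundary Omega].

(* A d-simplex is given by its d+1 vertices, the rows of a matrix; [l] is the
   row of barycentric coordinates. *)
Definition barycentric (l : 'rV[R]_d.+1) :=
  (forall i, 0 <= l ord0 i) /\ \sum_i l ord0 i = 1.

Definition simplex (K : 'M[R]_(d.+1, d)) : set Rd :=
  [set x | exists l, barycentric l /\ x = l *m K].

Definition affinely_independent (K : 'M[R]_(d.+1, d)) :=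
  row_free (row_mx K (const_mx 1 : 'cV[R]_d.+1)).

(* The (possibly empty) face of [K] spanned by the vertices shared with [K']. *)
Definition common_face (K K' : 'M[R]_(d.+1, d)) : set Rd :=
  [set x | exists l, [/\ barycentric l, x = l *m K &
     forall i, l ord0 i != 0 -> exists j, row i K = row j K']].

Definition triangulation (Omega : set Rd) (Th : seq 'M[R]_(d.+1, d)) :=
  [/\ forall K, K \in Th -> affinely_independent K,
      closure Omega = \bigcup_(K in [set` Th]) simplex K &
      forall K K', K \in Th -> K' \in Th ->
        simplex K `&` simplex K' = common_face K K'].

Definition diameter (A : set Rd) : R :=
  sup [set r | exists x y, [/\ A x, A y & r = enorm (x - y)]].

Definition mesh_size (Th : seq 'M[R]_(d.+1, d)) : R :=
  \big[Num.max/0]_(K <- Th) diameter (simplex K).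

(* Every element contains a ball of radius [kappa * h], h the mesh size. *)
Definition quasi_uniform (kappa : R) (Th : seq 'M[R]_(d.+1, d)) :=
  forall K, K \in Th -> exists c,
    [set x | enorm (x - c) <= kappa * mesh_size Th] `<=` simplex K.

Definition polynomial_on (A : set Rd) (u : Rd -> R) :=
  exists (r : nat) (c : {ffun 'I_d -> 'I_r} -> R),
    forall x, A x ->
      u x = \sum_(a : {ffun 'I_d -> 'I_r}) c a * \prod_i x ord0 i ^+ a i.

Definition piecewise_polynomial (Th : seq 'M[R]_(d.+1, d)) (u : Rd -> R) :=
  forall K, K \in Th -> polynomial_on (simplex K) u.

Definition finite_dim (E : lmodType R) (V : set (Rd -> E)) :=
  exists (n : nat) (b : 'I_n -> Rd -> E),
    V = [set u | exists c : 'I_n -> R, u = fun x => \sum_i c i *: b i x].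

Definition fe_function (Omega : set Rd) (Th : seq 'M[R]_(d.+1, d))
    (u : Rd -> R) :=
  {within closure Omega, continuous u} /\ piecewise_polynomial Th u.

End geometry.

Section fe_spaces.
Context {R : realType} (d : nat).
Local Notation Rd := 'rV[R]_d.

Record fe_spaces := FESpaces {
  mesh : seq 'M[R]_(d.+1, d) ;
  Vh : set (Rd -> R) ;
  Xh : set (Rd -> Rd) ;
  Nh : set (Rd -> R) }.

Definition Mh (Omega : set Rd) (F : fe_spaces) : set (Rd -> R) :=
  [set q | Nh F q /\ \int[lebesgue_rV d]_(x in Omega) q x = 0].

Definition inf_sup (Omega : set Rd) (F : fe_spaces) : \bar R :=
  ereal_inf [set
    ereal_sup [set
      (ip Omega (diver Omega v) q / (H1normv Omega v * l2norm Omega q))%:E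
      | v in [set v | Xh F v /\ H1normv Omega v != 0]]
    | q in [set q | Mh Omega F q /\ l2norm Omega q != 0]].

Definition conforming_fe_spaces (Omega : set Rd) (kappa C0 : R)
    (F : fe_spaces) :=
  [/\ triangulation Omega (mesh F) /\ quasi_uniform kappa (mesh F),
      [/\ finite_dim (E := R^o) (Vh F), finite_dim (Xh F) &
          finite_dim (E := R^o) (Nh F)],
      [/\ forall u, Vh F u -> H1 Omega u /\ fe_function Omega (mesh F) u,
          forall w, Xh F w -> forall i : 'I_d,
            H10 Omega (vcomp w i) /\ fe_function Omega (mesh F) (vcomp w i) &
          forall q, Nh F q -> H1 Omega q /\ fe_function Omega (mesh F) q] &
      (C0%:E <= inf_sup Omega F)%E].

End fe_spaces.

Arguments fe_spaces R d : clear implicits.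

Section scheme.
Context {R : realType} (d : nat).
Local Notation Rd := 'rV[R]_d.
Local Notation leb := (@lebesgue_rV R d).

(* [Rey] is the Reynolds number, [stab] the s and [shift] the S of the scalar
   auxiliary variable, [tfin] the final time T. *)
Record parameters := ParametersOf {
  Cn : R ; Pe : R ; Rey : R ; We : R ; Fr : R ;
  rho1 : R ; rho2 : R ; eta1 : R ; eta2 : R ; rhor : R ; etar : R ;
  stab : R ; shift : R ; tfin : R ; zeta : R }.

(* [phi_init] is the initial order parameter, the others are discrete. *)
Record initial_data := InitialData {
  phi_init : Rd -> R ;
  phi_h0 : Rd -> R ;
  mu_h0 : Rd -> R ;
  u_h0 : Rd -> Rd ;
  P_h0 : Rd -> R }.

(* [force n.+1] is the force used in the step from n to n.+1. *)
Record trajectory := Trajectory {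
  phase : nat -> Rd -> R ;
  chempot : nat -> Rd -> R ;
  vel : nat -> Rd -> Rd ;
  pres : nat -> Rd -> R ;
  Rv : nat -> R ;
  Qv : nat -> R ;
  force : nat -> Rd -> Rd }.

Definition varrho (p : parameters) : R := Num.min (rho1 p) (rho2 p) / rhor p.

Definition admissible (p : parameters) :=
  [/\ [/\ 0 < Cn p, 0 < Pe p, 0 < Rey p, 0 < We p & 0 < Fr p],
      [/\ 0 < rho1 p, 0 < rho2 p, 0 < eta1 p & 0 < eta2 p],
      [/\ 0 < rhor p, 0 < etar p, 0 < stab p & 0 < shift p],
      0 < tfin p & 3 * varrho p <= zeta p].

Variables (p : parameters) (Omega : set Rd).

Definition Fpot (x : R) : R := 4^-1 * (x ^+ 2 - 1) ^+ 2.

Definition Gpot (x : R) : R := Fpot x - stab p / 2 * x ^+ 2.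

Definition cutoff (x : R) : R := if `|x| <= 1 then x else Num.sg x.

Definition density (x : R) : R :=
  (rho1 p - rho2 p) / (2 * rhor p) * cutoff x +
  (rho1 p + rho2 p) / (2 * rhor p).

Definition viscosity (x : R) : R :=
  (eta1 p - eta2 p) / (2 * etar p) * cutoff x +
  (eta1 p + eta2 p) / (2 * etar p).

Definition sigma (x : R) : R := Num.sqrt (density x).

Definition shifted_energy (f : Rd -> R) : R :=
  \int[leb]_(x in Omega) Gpot (f x) + shift p.

Definition Ufun (f : Rd -> R) : R := Num.sqrt (shifted_energy f).

Variables (tau : R) (z : trajectory).

Definition time (n : nat) : R := n%:R * tau.

Definition dtau (E : lmodType R) (chi : nat -> E) (n : nat) : E :=
  tau^-1 *: (chi n - chi n.-1).

(* chi~^n = chi^(n-1); at n = 0 it returns the initial value, as in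
   sigma~^0 = sigma(phi^0). *)
Definition extrap (E : Type) (chi : nat -> E) (n : nat) : E := chi n.-1.

Definition rhot n : Rd -> R := density \o extrap (phase z) n.

Definition etat n : Rd -> R := viscosity \o extrap (phase z) n.

Definition sigmat n : Rd -> R := sigma \o extrap (phase z) n.

Definition sigmau n : Rd -> Rd := fun x => sigmat n x *: vel z n x.

Definition Ut n : R := Ufun (extrap (phase z) n).

Definition Jt n : Rd -> Rd := fun x =>
  - ((rho1 p - rho2 p) / (2 * rhor p * Pe p)) *:
    grad Omega (extrap (chempot z) n) x.

Definition xi1 n : R := Rv z n / Ut n.

Definition xi2 n : R := expR (time n / tfin p) * Qv z n.

Definition wt n : Rd -> Rd := fun x =>
  rhot n x *: extrap (vel z) n x + Jt n x.

Definition Bform n (v : Rd -> Rd) : R :=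
  ipm Omega (advect Omega (wt n) (extrap (vel z) n)) v -
  ipm Omega (advect Omega (wt n) v) (extrap (vel z) n).

Definition Psharp n : Rd -> R :=
  if n is m.+1 then 2 *: (pres z m.+1 : Rd -> R^o) - pres z m else pres z 0.

Definition phiu n : Rd -> Rd := fun x =>
  extrap (phase z) n x *: extrap (vel z) n x.

Definition phigradmu n : Rd -> Rd := fun x =>
  extrap (phase z) n x *: grad Omega (extrap (chempot z) n) x.

Definition dGpot n : Rd -> R := derive1 Gpot \o extrap (phase z) n.

Definition dphi n : Rd -> R := dtau (fun k => phase z k : Rd -> R^o) n.

(* The equations below are those of time level [n] (>= 1), computed from level
   [n.-1]. *)
Definition eq_phase (F : fe_spaces R d) n := forall omega, Vh F omega ->
  ip Omega (dphi n) omega =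
  xi1 n * ipm Omega (phiu n) (grad Omega omega) -
  (Pe p)^-1 * ipm Omega (grad Omega (chempot z n)) (grad Omega omega).

Definition eq_potential (F : fe_spaces R d) n := forall psi, Vh F psi ->
  ip Omega (chempot z n) psi =
  Cn p ^+ 2 * ipm Omega (grad Omega (phase z n)) (grad Omega psi) +
  stab p * ip Omega (phase z n) psi +
  xi1 n * ip Omega (dGpot n) psi.

Definition eq_R n :=
  (Rv z n - Rv z n.-1) / tau =
  (2 * Ut n)^-1 *
  (ip Omega (dGpot n) (dphi n) -
   ipm Omega (phiu n) (grad Omega (chempot z n)) +
   ipm Omega (phigradmu n) (vel z n)).

Definition eq_momentum (F : fe_spaces R d) n := forall v, Xh F v ->
  ipm Omega (fun x => sigmat n x *: dtau sigmau n x) v +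
  zeta p * ip Omega (diver Omega (dtau (vel z) n)) (diver Omega v) +
  2 / Rey p * ipm Omega (fun x => etat n x *: symgrad Omega (vel z n) x)
                        (symgrad Omega v) =
  - (xi2 n / 2) * Bform n v +
  ip Omega (Psharp n.-1) (diver Omega v) -
  xi1 n / (We p * Cn p) * ipm Omega (phigradmu n) v +
  (Fr p)^-1 * ipm Omega (force z n) v.

Definition eq_pressure (F : fe_spaces R d) n := forall q, Nh F q ->
  ip Omega (pres z n - pres z n.-1) q =
  - (varrho p / tau) * ip Omega (diver Omega (vel z n)) q.

Definition eq_Q n :=
  (Qv z n - Qv z n.-1) / tau =
  - (Qv z n / tfin p) +
  2^-1 * expR (time n / tfin p) * Bform n (vel z n).

Definition AC_step (F : fe_spaces R d) n :=
  [/\ [/\ Vh F (phase z n), Vh F (chempot z n), Xh F (vel z n) & Nh F (pres z n)],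
      eq_phase F n /\ eq_potential F n, eq_R n,
      eq_momentum F n /\ eq_pressure F n & eq_Q n].

Definition starts_from (D : initial_data) :=
  [/\ phase z 0 = phi_h0 D, chempot z 0 = mu_h0 D, vel z 0 = u_h0 D &
      pres z 0 = P_h0 D] /\
  Rv z 0 = Num.sqrt (shifted_energy (phi_init D)) /\ Qv z 0 = 1.

(* [M] is the number T / tau of time steps. *)
Definition AC_solution (F : fe_spaces R d) (D : initial_data) (M : nat) :=
  starts_from D /\ forall n, (n < M)%N -> AC_step F n.+1.

Definition energy n : R :=
  l2normm Omega (sigmau n) ^+ 2 +
  Cn p / We p * l2normm Omega (grad Omega (phase z n)) ^+ 2 +
  stab p / (We p * Cn p) * l2norm Omega (phase z n) ^+ 2 +
  2 / (We p * Cn p) * `|Rv z n| ^+ 2 +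
  `|Qv z n| ^+ 2 +
  zeta p * l2norm Omega (diver Omega (vel z n)) ^+ 2 +
  tau ^+ 2 / varrho p * l2norm Omega (pres z n) ^+ 2.

Definition dissipation n : R :=
  4 / Rey p *
    l2normm Omega (fun x => Num.sqrt (viscosity (phase z n.-1 x)) *:
                          symgrad Omega (vel z n) x) ^+ 2 +
  2 / tfin p * `|Qv z n| ^+ 2 +
  2 / (Pe p * We p * Cn p) * l2normm Omega (grad Omega (chempot z n)) ^+ 2.

End scheme.

Arguments parameters R : clear implicits.
Arguments initial_data R d : clear implicits.
Arguments trajectory R d : clear implicits.

(* Main.v *)
Require Import Defs.
From mathcomp Require Import all_boot all_order all_algebra.
From mathcomp Require Import all_classical all_reals all_analysis.
From mathcomp Require Import measurable_realfun ring lra.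
Import Order.TTheory GRing.Theory Num.Theory.
Import numFieldNormedType.Exports.
Local Open Scope classical_set_scope.
Local Open Scope ring_scope.

(** The law is obtained by testing each equation of a step with the matching
unknown of the new level: the phase equation with [mu], the potential equation
with the increment of [phi], the momentum equation with [u]; the scalar
equations are multiplied by [2 R] and [2 Q]. Every backward difference then
contributes, by polarisation ([ip_backward_difference]), a difference of squares
and a nonnegative square of the increment. The two explicit couplings cancel:
the advection form [B] against the equation of [Q], and the exchange between
phase and momentum against the equation of [R] ([energy_balance]). What is left
is the pairing of the extrapolated pressure [P#] with the divergence of the new
velocity.

The pressure equation turns this pairing into products of increments of the
pressure. For a step with two predecessors the extrapolation differs from the
new pressure by a second difference, and the pairing telescopes up to the square
of that second difference ([pressure_coupling]). By the pressure equation the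
second difference represents, on the pressure space, the divergence of the
increment of the velocity, so its square is dominated by the grad-div
dissipation, because [zeta >= 3 varrho]. In the first step only a first
difference is available, which costs an additional multiple of the square of the
initial divergence ([pressure_coupling0]). Summing gives
[E^N + tau sum P^k <= E^0 + 2 varrho |div u^0|^2], where the only dependence of
[E^0] on the time step, [tau^2 |P^0|^2 / varrho], is bounded using [tau <= T].

Polarisation needs the weak derivative of a difference quotient to be the
difference quotient of the weak derivatives. Weak derivatives are arbitrarily
chosen representatives, so this holds almost everywhere and only because weak
derivatives are unique ([weak_partial_uniq]), that is, because an integrable
function orthogonal to all test functions vanishes almost everywhere
([ae_eq0_test_function]). That lemma is proved with products of one-dimensional
functions [exp (- 1 / s)]: rescaled, they increase to the indicator of an open
box, so the integrals over boxes vanish, and boxes generate the Borel sets. *)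

(** * Boxes and the Borel sets of R^d *)

Section boxes.
Context {R : realType} {d : nat}.
Implicit Types (a b x : 'rV[R]_d).

Definition open_box a b : set 'rV[R]_d :=
  [set x | forall i, a ord0 i < x ord0 i < b ord0 i].

Definition closed_box a b : set 'rV[R]_d :=
  [set x | forall i, a ord0 i <= x ord0 i <= b ord0 i].

Lemma open_box_sub_closed_box a b : open_box a b `<=` closed_box a b.
Proof. by move=> x abx i; have /andP[/ltW -> /ltW ->] := abx i. Qed.

Lemma compact_closed_box a b : compact (closed_box a b).
Proof.
have := @rV_compact R d (fun i => [set` `[a ord0 i, b ord0 i]]).
move=> /(_ (fun i => @segment_compact _ _ _)).
by congr (compact _); apply/seteqP; split => x abx i; have := abx i;
  rewrite /= in_itv.
Qed.

Lemma closed_closed_box a b : closed (closed_box a b).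
Proof.
apply: compact_closed; last exact: compact_closed_box.
exact: norm_hausdorff.
Qed.

Lemma measurable_open_box a b : measurable (open_box a b).
Proof.
have -> : open_box a b = \bigcap_(i in [set: 'I_d])
    ([set: 'rV[R]_d] `&` (fun x : 'rV[R]_d => x ord0 i) @^-1`
      [set` `]a ord0 i, b ord0 i[]).
  apply/seteqP; split => x /= abx i.
    by move=> _; split => //=; rewrite in_itv/=; exact: abx.
  by have [//|_ /=] := abx i; rewrite in_itv.
apply: fin_bigcap_measurable; first exact: finite_finset.
by move=> i _; apply: measurable_coord => //; exact: measurable_itv.
Qed.

Lemma open_boxI a b a' b' : open_box a b `&` open_box a' b' =
  open_box (map2_mx Num.max a a') (map2_mx Num.min b b').
Proof.
apply/seteqP; split=> x /=.
  move=> [h h'] i; rewrite !mxE gt_max lt_min.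
  by have /andP[-> ->] := h i; have /andP[-> ->] := h' i.
move=> h; split=> i; have := h i; rewrite !mxE gt_max lt_min.
  by move=> /andP[/andP[-> _] /andP[-> _]].
by move=> /andP[/andP[_ ->] /andP[_ ->]].
Qed.

(** Second countability, with rational centres and radii [1 / (n + 1)]. The
    closed boxes are kept inside the open set because they will carry the
    supports of test functions. *)
Lemma open_bigcup_box (A : set 'rV[R]_d) : open A ->
  exists (P : set nat) (a b : nat -> 'rV[R]_d),
    (forall k, P k -> closed_box (a k) (b k) `<=` A) /\
    A = \bigcup_(k in P) open_box (a k) (b k).
Proof.
move=> oA.
pose lo (c : 'rV[rat]_d * nat) : 'rV[R]_d :=
  \row_i (ratr (c.1 ord0 i) - c.2.+1%:R^-1).
pose hi (c : 'rV[rat]_d * nat) : 'rV[R]_d :=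
  \row_i (ratr (c.1 ord0 i) + c.2.+1%:R^-1).
pose P : set nat := [set k | exists2 c : 'rV[rat]_d * nat,
  k = pickle c & closed_box (lo c) (hi c) `<=` A].
(* [P] only contains codes, so the default value is irrelevant *)
pose code (k : nat) : 'rV[rat]_d * nat := odflt (0, 0%N) (unpickle k).
have codeK c : code (pickle c) = c by rewrite /code pickleK.
exists P, (lo \o code), (hi \o code); split.
  by move=> k [c -> cA] /=; rewrite codeK.
apply/seteqP; split; last first.
  by move=> x [k [c -> cA]] /=; rewrite codeK => /open_box_sub_closed_box/cA.
move=> x Ax; have /nbhs_ballP[e /= e0 xeA] := oA _ Ax.
have [n ne] : exists n, n.+1%:R^-1 < e / 2.
  have e20 : 0 < e / 2 by rewrite divr_gt0.
  exists (Num.truncn (e / 2)^-1).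
  rewrite -[ltRHS]invrK ltf_pV2 ?posrE ?invr_gt0//.
  exact: truncnS_gt.
have n0 : 0 < n.+1%:R^-1 :> R by rewrite invr_gt0.
have /choice[q qx] : forall i, exists q : rat,
    x ord0 i - n.+1%:R^-1 < ratr q < x ord0 i + n.+1%:R^-1.
  move=> i.
  have xx : x ord0 i - n.+1%:R^-1 < x ord0 i + n.+1%:R^-1.
    by rewrite ltrD2l (lt_trans _ n0)// oppr_lt0.
  have [q] := rat_in_itvoo xx; rewrite in_itv/= => qx.
  by exists q.
pose c := (\row_i q i, n) : 'rV[rat]_d * nat.
exists (pickle c).
  exists c => // y yc; apply: xeA; split=> // j i; rewrite (ord1 j) {j}.
  have := yc i; have := qx i; rewrite !mxE /ball/= ltr_norml.
  move: (n.+1%:R^-1) ne => t ne.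
  move=> /andP[? ?] /andP[? ?]; apply/andP; split; lra.
rewrite /= codeK => i; rewrite !mxE; have := qx i.
by move: (n.+1%:R^-1) => t /andP[? ?]; apply/andP; split; lra.
Qed.

(** The coordinate sigma-algebra is the Borel one. *)
Lemma measurable_open (A : set 'rV[R]_d) : open A -> measurable A.
Proof.
move=> /open_bigcup_box[P [a [b [_ ->]]]].
by apply: bigcup_measurable => k _; exact: measurable_open_box.
Qed.

Lemma measurable_fun_continuous (f : 'rV[R]_d -> R) (A : set 'rV[R]_d) :
  measurable A -> continuous f -> measurable_fun A f.
Proof.
move=> mA cf; apply: (measurable_funS measurableT) => //.
apply: (measurability _ (RGenOpens.measurableE R)) => //.
move=> _ [B [x [y ->]] <-]; rewrite setTI; apply: measurable_open.
by apply: open_comp => // z _; exact: cf.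
Qed.

End boxes.

Lemma lebesgue_rV_box_lty {R : realType} d (r : R) :
  (lebesgue_rV d (open_box (const_mx (- r)%R) (const_mx r)) < +oo)%E.
Proof.
elim: d => [|d IHd] /=.
  by rewrite /dirac /= indicE; case: (_ \in _); rewrite ltry.
rewrite /lebesgue_step /pushforward.
rewrite (_ : _ @^-1` _ =
    `]- r, r[%classic `*` open_box (const_mx (- r)) (const_mx r)).
  rewrite product_measure1E//=; last exact: measurable_open_box.
  rewrite lte_mul_pinfty//.
  rewrite ge0_fin_numE//= lebesgue_measure_itv/=.
  by case: ifP => // _; rewrite ltry.
apply/seteqP; split=> -[t y] /=.
  move=> h; split=> [|i].
    have := h (lshift d (ord0 : 'I_1)).
    by rewrite /consrV (@row_mxEl _ 1 1 d) !mxE in_itv.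
  by have := h (rshift 1 i); rewrite /consrV (@row_mxEr _ 1 1 d) !mxE.
rewrite in_itv/= => -[tr yr] i.
case: (@split_ordP 1 d i) => j ->; rewrite /consrV.
  by rewrite (@row_mxEl _ 1 1 d) !mxE.
by have := yr j; rewrite (@row_mxEr _ 1 1 d) !mxE.
Qed.

Lemma bounded_sub_open_box {R : realType} d (A : set 'rV[R]_d) :
  bounded_set A ->
  exists r : R, A `<=` open_box (const_mx (- r)) (const_mx r).
Proof.
move=> [M [Mr AM]]; exists (`|M| + 2) => x Ax i; rewrite !mxE -ltr_norml.
have M1 : M < `|M| + 1 by rewrite (le_lt_trans (ler_norm _))// ltrDl.
apply: (@le_lt_trans _ _ (`|M| + 1)); last by rewrite ltrD2l ltr1n.
apply: le_trans (AM _ M1 _ Ax); rewrite [leRHS]/Num.Def.normr/= mx_normrE.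
exact: (le_bigmax _ (fun ij => `|x ij.1 ij.2|) (ord0, i)).
Qed.

Lemma lebesgue_rV_bounded_lty {R : realType} d (A : set 'rV[R]_d) :
  measurable A -> bounded_set A -> (lebesgue_rV d A < +oo)%E.
Proof.
move=> mA /bounded_sub_open_box[r Ar].
apply: (le_lt_trans _ (lebesgue_rV_box_lty d r)).
by rewrite le_measure ?inE//; exact: measurable_open_box.
Qed.

(** * Smooth bump functions *)

Section flat.
Context {R : realType}.
Implicit Types (p : {poly R}) (s : R).

(** With [p = 1] this is the classical smooth function that is flat at [0]; the
    polynomial factor makes the family stable under differentiation. *)
Definition flat p s : R := if 0 < s then p.[s^-1] * expR (- s^-1) else 0.

Lemma poly_expR_bound p :
  exists C : R, forall s, 0 < s -> `|p.[s]| <= C * expR s.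
Proof.
exists (\sum_(i < size p) `|p`_i| * i`!%:R) => s s0.
rewrite horner_coef mulr_suml (le_trans (ler_norm_sum _ _ _))//.
apply: ler_sum => i _; rewrite normrM -mulrA ler_wpM2l//.
rewrite ger0_norm ?exprn_ge0 ?(ltW s0)//.
case: (nat_of_ord i) => [|n].
  by rewrite expr0 fact0 mul1r (le_trans _ (expR_ge1Dx s))// lerDl ltW.
rewrite -ler_pdivrMl ?ltr0n ?fact_gt0// mulrC.
by have := expR_ge1Dxn n (ltW s0); apply: le_trans; rewrite lerDr.
Qed.

(** Any exponent above [1] would do: this makes [flat p] differentiable at [0]
    with derivative [0]. *)
Lemma flat_le_sqr p : exists C : R, forall s, `|flat p s| <= C * s ^+ 2.
Proof.
have [C pC] := poly_expR_bound (p * 'X^2).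
have C0 : 0 <= C.
  by have := pC 1 ltr01; rewrite -ler_pdivrMr ?expR_gt0//; apply: le_trans;
    rewrite divr_ge0// expR_ge0.
exists C => s; rewrite /flat; case: ifPn => [s0|_]; last first.
  by rewrite normr0 mulr_ge0// sqr_ge0.
have s20 : 0 < s^-1 ^+ 2 by rewrite exprn_gt0// invr_gt0.
have := pC s^-1; rewrite invr_gt0 => /(_ s0).
rewrite hornerM hornerXn normrM (gtr0_norm s20) normrM (gtr0_norm (expR_gt0 _)).
rewrite expRN -ler_pdivlMr// exprVn invrK => h.
by rewrite ler_pdivrMr ?expR_gt0// mulrAC.
Qed.

(** At [0] this is the quadratic bound [flat_le_sqr]; elsewhere it is the chain
    rule for [p (1 / s) * exp (- 1 / s)]. *)
Lemma is_derive_flat p s :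
  is_derive s (1 : R) (flat p) (flat ('X^2 * (p - p^`())) s).
Proof.
have [s0|s0|->] := ltgtP s 0.
- rewrite /flat ltNge (ltW s0)/=.
  apply: (@near_eq_is_derive R R R (cst 0)).
  near=> t; rewrite ltNge (_ : t <= 0)//.
  by rewrite ltW//; near: t; exact: lt_nbhsl.
- apply: (@near_eq_is_derive R R R
    ((fun t => p.[t^-1]) * (fun t => expR (- t^-1)))).
    near=> t; rewrite /flat ifT//; near: t; exact: lt_nbhsr.
  have sn0 : s != 0 by rewrite gt_eqF.
  have dV : is_derive s (1 : R) (fun t : R => t^-1) (- s ^- 2).
    have := @is_deriveV R id s 1 1 sn0 (is_derive_id _ _).
    by rewrite /= /GRing.scale/= mulr1.
  have dNV : is_derive s (1 : R) (fun t : R => - t^-1) (s ^- 2).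
    by have := is_deriveN dV; rewrite opprK.
  have dp := @is_derive1_comp _ (horner p) (fun t => t^-1) _ _ _
    (is_derive_poly p _) dV.
  have de := @is_derive1_comp _ expR (fun t => - t^-1) _ _ _
    (is_derive_expR _) dNV.
  apply: (is_derive_eq (is_deriveM dp de)).
  rewrite /flat s0 !hornerE /GRing.scale/=; by field.
- have f0 q : flat q 0 = 0 by rewrite /flat ltxx.
  have [C pC] := flat_le_sqr p.
  have C0 : 0 <= C by have := pC 1; rewrite expr1n mulr1; exact: le_trans.
  have lim0 : (fun h => h^-1 *: ((flat p \o shift 0) (h *: (1 : R)) - flat p 0))
      @ 0^' --> (0 : R).
    apply/cvgr0Pnorm_le => e e0; near=> h.
    rewrite /= /shift/= /GRing.scale/= addr0 mulr1 f0 subr0 normrM.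
    have h0 : h != 0 by near: h; exact: nbhs_dnbhs_neq.
    rewrite normrV ?unitfE// ler_pdivrMl ?normr_gt0//.
    rewrite (le_trans (pC h))// -[h ^+ 2]ger0_norm ?sqr_ge0// normrX expr2.
    rewrite mulrCA ler_wpM2l//.
    rewrite (@le_trans _ _ ((C + 1) * `|h|))//.
      by rewrite ler_wpM2r// lerDl.
    rewrite -ler_pdivlMl ?ltr_wpDl//; near: h; apply: dnbhs0_le.
    by rewrite mulr_gt0// invr_gt0 ltr_wpDl.
  by split; [apply/cvg_ex; exists 0|rewrite f0; exact/cvg_lim].
Unshelve. all: by end_near. Qed.

Lemma continuous_flat p : continuous (flat p).
Proof.
move=> s; apply/differentiable_continuous/derivable1_diffP.
by have [] := is_derive_flat p s.
Qed.

End flat.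

Section flat_algebra.
Context {R : realType} {d : nat}.
Local Notation Rd := 'rV[R]_d.

(** The partial derivatives of a member are again members
    ([flat_algebra_partial]), so that membership alone gives smoothness and no
    higher derivative has to be computed. *)
Inductive flat_algebra : (Rd -> R) -> Prop :=
| flat_algebra_atom p (i : 'I_d) (c e : R) :
    flat_algebra (fun x => flat p (c * x ord0 i + e))
| flat_algebra_cst k : flat_algebra (cst k)
| flat_algebraD f g : flat_algebra f -> flat_algebra g -> flat_algebra (f + g)
| flat_algebraM f g : flat_algebra f -> flat_algebra g -> flat_algebra (f * g).

Lemma flat_algebra_continuous f : flat_algebra f -> continuous f.
Proof.
elim=> {f} [p i c e|k|f g _ cf _ cg|f g _ cf _ cg] x.
- apply: (@continuous_comp _ _ _ (fun x : Rd => x ord0 i)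
    (fun t => flat p (c * t + e))); first exact: coord_continuous.
  apply: (@continuous_comp _ _ _ (fun t => c * t + e) (flat p));
    last exact: continuous_flat.
  apply: continuousD; last exact: cvg_cst.
  by apply: continuousM; [exact: cvg_cst|exact: cvg_id].
- exact: cst_continuous.
- exact: continuousD (cf x) (cg x).
- exact: continuousM (cf x) (cg x).
Qed.

(** Reduces directional derivatives to the one-dimensional theory. *)
Lemma is_derive_line (f : Rd -> R) (x v : Rd) (df : R) :
  is_derive (0 : R) (1 : R) (fun h : R => f (h *: v + x)) df ->
  is_derive x v f df.
Proof.
have E : (fun h : R => h^-1 *:
    (((fun h : R => f (h *: v + x)) \o shift 0) (h *: (1 : R)) - f (0 *: v + x)))
  = (fun h : R => h^-1 *: ((f \o shift x) (h *: v) - f x)).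
  by apply/funext => h; rewrite /= /shift/= addr0 [h *: 1]mulr1 scale0r add0r.
by case; rewrite /derivable /derive E => cf df0; split.
Qed.

Lemma flat_algebra_partial f (j : 'I_d) : flat_algebra f ->
  exists2 g, flat_algebra g &
    forall x, is_derive x (delta_mx ord0 j : Rd) f (g x).
Proof.
elim=> {f} [p i c e|k|f g Af [f' Af' ff'] Ag [g' Ag' gg']
           |f g Af [f' Af' ff'] Ag [g' Ag' gg']].
- exists (cst (c * (i == j)%:R) *
      (fun x => flat ('X^2 * (p - p^`())) (c * x ord0 i + e))).
    by apply: flat_algebraM; [exact: flat_algebra_cst|exact: flat_algebra_atom].
  move=> x; apply: is_derive_line.
  pose k : R := c * (i == j)%:R; pose m : R := c * x ord0 i + e.
  have dl : is_derive (0 : R) (1 : R) (k \*: (@id R) + cst m) k.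
    by apply: is_derive_eq; rewrite addr0 [k *: 1]mulr1.
  have -> : (fun h : R =>
      flat p (c * (h *: (delta_mx ord0 j : Rd) + x) ord0 i + e)) =
      flat p \o (k \*: (@id R) + cst m).
    apply/funext => h; rewrite /= !mxE eqxx/= /m /k; congr (flat p _).
    by rewrite -[LHS]/(c * (h * (i == j)%:R + x ord0 i) + e)
      -[RHS]/(c * (i == j)%:R * h + (c * x ord0 i + e)); ring.
  have l0 : (k \*: (@id R) + cst m) 0 = m.
    by rewrite -[LHS]/(k * 0 + m) mulr0 add0r.
  have := is_derive_flat p m; rewrite -[in X in X -> _]l0 => df.
  by apply: (is_derive_eq (is_derive1_comp df dl)); rewrite l0 mulrC.
- exists (cst 0); [exact: flat_algebra_cst|by move=> x; exact: is_derive_cst].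
- exists (f' + g'); first exact: flat_algebraD.
  by move=> x; exact: is_deriveD.
- exists (f * g' + g * f'); first by apply: flat_algebraD; exact: flat_algebraM.
  by move=> x; exact: is_deriveM.
Qed.

Lemma flat_algebra_smooth f : flat_algebra f -> smooth f.
Proof.
move=> Af s; have {Af}Af : flat_algebra (iter_partial s f).
  elim: s => //= j s Asf; have [g Ag gd] := flat_algebra_partial _ j Asf.
  rewrite (_ : partial j _ = g)//; apply/funext => x.
  by have gx := gd x; exact: derive_val.
split; first exact: flat_algebra_continuous.
by move=> j x; have [g _ /(_ x)[]] := flat_algebra_partial _ j Af.
Qed.

(** Rescaling a function vanishing to infinite order at the faces of the box
    makes it increase to the indicator of the open box. *)
Definition box_bump (a b : Rd) (k : nat) (x : Rd) : R :=
  \prod_i (flat 1 (k.+1%:R * (x ord0 i - a ord0 i)) *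
           flat 1 (k.+1%:R * (b ord0 i - x ord0 i))).

Lemma flat1_itv (s : R) : 0 <= flat 1 s <= 1.
Proof.
rewrite /flat; case: ifPn => s0; last by rewrite lexx ler01.
by rewrite hornerE mul1r expR_ge0 -expR0 ler_expR oppr_le0 invr_ge0 ltW.
Qed.

Lemma box_bump_itv a b k x : 0 <= box_bump a b k x <= 1.
Proof.
rewrite /box_bump; elim/big_ind: _ => [|u v /andP[u0 u1] /andP[v0 v1]|i _].
- by rewrite ler01 lexx.
- by rewrite mulr_ge0// mulr_ile1.
- have /andP[? ?] := flat1_itv (k.+1%:R * (x ord0 i - a ord0 i)).
  have /andP[? ?] := flat1_itv (k.+1%:R * (b ord0 i - x ord0 i)).
  by rewrite mulr_ge0// mulr_ile1.
Qed.

Lemma box_bump_out a b k x : ~ open_box a b x -> box_bump a b k x = 0.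
Proof.
move=> /existsNP[i /negP]; rewrite negb_and -!leNgt => abx.
have flat0 t : t <= 0 -> flat 1 (k.+1%:R * t) = 0.
  by move=> t0; rewrite /flat pmulr_rgt0 ?ltr0n// ltNge t0.
rewrite /box_bump (bigD1 i)//=; case/orP: abx => h.
  by rewrite flat0 ?subr_le0// !mul0r.
by rewrite [X in _ * X * _]flat0 ?subr_le0// mulr0 mul0r.
Qed.

Lemma cvg_flat1 (s : R) : 0 < s ->
  (fun k : nat => flat 1 (k.+1%:R * s)) @ \oo --> (1 : R).
Proof.
move=> s0.
rewrite (_ : (fun _ => _) = expR \o (fun k : nat => - (k.+1%:R^-1 * s^-1))).
  rewrite -[X in _ --> X]expR0; apply: continuous_cvg.
    exact: continuous_expR.
  rewrite -oppr0 -[X in - X](mul0r s^-1); apply: cvgN; apply: cvgM.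
    exact: cvg_harmonic.
  exact: cvg_cst.
apply/funext => k; rewrite /flat mulr_gt0//= hornerE mul1r invfM.
by rewrite mulrC.
Qed.

Lemma cvg_prod1 (I : Type) (s : seq I) (F : nat -> I -> R) :
  (forall i, F^~ i @ \oo --> (1 : R)) ->
  (fun k => \prod_(i <- s) F k i) @ \oo --> (1 : R).
Proof.
move=> cF; elim: s => [|i s IHs].
  have -> : (fun k => \prod_(i <- [::]) F k i) = cst (1 : R).
    by apply/funext => k; rewrite big_nil.
  exact: cvg_cst.
have -> : (fun k => \prod_(j <- i :: s) F k j) =
    (fun k => F k i * \prod_(j <- s) F k j).
  by apply/funext => k; rewrite big_cons.
by have := cvgM (cF i) IHs; rewrite mulr1; apply.
Qed.

Lemma cvg_box_bump a b x : open_box a b x ->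
  (fun k => box_bump a b k x) @ \oo --> (1 : R).
Proof.
move=> abx; apply: cvg_prod1 => i; have /andP[ax xb] := abx i.
rewrite -subr_gt0 in ax; rewrite -subr_gt0 in xb.
by have := cvgM (cvg_flat1 _ ax) (cvg_flat1 _ xb); rewrite mulr1; apply.
Qed.

Lemma test_function_box_bump (Omega : set Rd) a b k :
  closed_box a b `<=` Omega -> test_function Omega (box_bump a b k).
Proof.
move=> abO.
have supp : closure [set x | box_bump a b k x != 0] `<=` closed_box a b.
  have /closure_id -> := closed_closed_box a b.
  apply: closure_subset => x /= /eqP nz; apply: open_box_sub_closed_box.
  by apply: contrapT => /box_bump_out.
split; last exact: subset_trans abO.
  apply: flat_algebra_smooth.
  rewrite (_ : box_bump a b k = \prod_i ((fun x =>
    flat 1 (k.+1%:R * x ord0 i + - (k.+1%:R * a ord0 i))) * (fun x =>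
    flat 1 (- k.+1%:R * x ord0 i + k.+1%:R * b ord0 i)))); last first.
    apply/funext => x; rewrite fct_prodE; apply: eq_bigr => i _.
    by congr (flat 1 _ * flat 1 _); ring.
  elim/big_ind: _ => [|f g|i _].
  - exact: flat_algebra_cst.
  - exact: flat_algebraM.
  - by apply: flat_algebraM; exact: flat_algebra_atom.
apply: (subclosed_compact _ (compact_closed_box a b)) => //.
exact: closed_closure.
Qed.

End flat_algebra.

(** * The fundamental lemma of the calculus of variations *)

Section generation.
Context {R : realType} {d : nat}.
Local Notation Rd := 'rV[R]_d.

Definition open_boxes : set (set Rd) := [set A | exists a b, A = open_box a b].

Lemma setI_closed_open_boxes : setI_closed open_boxes.
Proof.
move=> _ _ [a [b ->]] [a' [b' ->]]; rewrite open_boxI.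
by exists (map2_mx Num.max a a'), (map2_mx Num.min b b').
Qed.

Lemma open_sub_g_open_boxes (A : set Rd) : open A -> <<s open_boxes >> A.
Proof.
move=> /open_bigcup_box[P [a [b [_ ->]]]].
rewrite bigcup_mkcond; apply: sigma_algebra_bigcup => k.
case: ifPn => _; last exact: sigma_algebra0.
by apply: sub_sigma_algebra; exists (a k), (b k).
Qed.

(** A slab between two coordinate hyperplanes is open, hence a countable union
    of boxes, and the slabs generate the coordinate sigma-algebra. *)
Lemma measurable_sub_g_open_boxes (A : set Rd) :
  measurable A -> <<s open_boxes >> A.
Proof.
move: A; apply: smallest_sub; first exact: smallest_sigma_algebra.
rewrite -bigcup_seq; apply: bigcup_sub => i _ _ [B mB <-].
have : measurable_fun [set: g_sigma_algebraType open_boxes]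
    (fun x : Rd => x ord0 i : R).
  apply: (measurability _ (RGenOpens.measurableE R)) => //.
  move=> _ [_ [s [t ->]] <-]; rewrite setTI.
  apply: open_sub_g_open_boxes; apply: open_comp; last exact: interval_open.
  by move=> z _; exact: coord_continuous.
by move=> /(_ measurableT B mB).
Qed.

End generation.

Section fundamental_lemma.
Context {R : realType} {d : nat}.
Local Notation Rd := 'rV[R]_d.
Local Notation leb := (@lebesgue_rV R d).

(** The Borel sets over which the integral of [f] vanishes form a Dynkin system,
    and open boxes are a pi-system generating the Borel sets. *)
Lemma ae_eq0_open_box (f : Rd -> \bar R) (a b : Rd) :
  leb.-integrable (open_box a b) f ->
  (forall a' b', closed_box a' b' `<=` closed_box a b ->
    (\int[leb]_(x in open_box a' b') f x)%E = 0%E) ->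
  ae_eq leb (open_box a b) f (cst 0%E).
Proof.
move=> intf f0.
set B := open_box a b in intf *.
have mB : measurable B by exact: measurable_open_box.
have intG : leb.-integrable [set: Rd] (f \_ B).
  by apply: (@integrable_mkcond _ _ _ leb B f mB).1.
pose H : set (set Rd) :=
  [set A | measurable A /\ (\int[leb]_(x in A) (f \_ B) x)%E = 0%E].
have HT : (\int[leb]_x (f \_ B) x)%E = 0%E.
  by rewrite -integral_mkcond; apply: f0.
have dH : dynkin H.
  split.
  - by split.
  - move=> A [mA A0]; split; first exact: measurableC.
    have /integrableP[mG _] := intG.
    have := @integral_setU _ _ _ leb A (~` A) (f \_ B) mA (measurableC mA).
    by rewrite setUv disj_set2E setICr eqxx HT A0 add0e => <-.
  - move=> F tF HF; have mF k : measurable (F k) by have [] := HF k.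
    split; first exact: bigcupT_measurable.
    rewrite integral_bigcup//; last first.
      by apply: integrableS intG => //; exact: bigcupT_measurable.
    by apply: eseries0 => k _ _; have [_] := HF k.
have bH : open_boxes `<=` H.
  move=> _ [a' [b' ->]]; split; first exact: measurable_open_box.
  rewrite -integral_mkcondr open_boxI; apply: f0.
  by move=> x h i; have := h i; rewrite !mxE ge_max le_min =>
    /andP[/andP[_ ->] /andP[_ ->]].
have H0 A : measurable A -> H A.
  move=> /measurable_sub_g_open_boxes.
  rewrite -(setI_closed_g_dynkin_g_sigma_algebra setI_closed_open_boxes).
  by move: A; exact: smallest_sub.
apply: integral_ae_eq => // E EB mE.
rewrite integral0; have [_ <-] := H0 E mE; apply: eq_integral => x xE.
by rewrite patchT// inE; apply: EB; rewrite -inE.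
Qed.

(** Testing against the bumps of a box gives, in the limit, the integral over
    that box. *)
Lemma integral_open_box_eq0 (Omega : set Rd) (g : Rd -> R) (a b : Rd) :
  measurable Omega -> leb.-integrable Omega (EFin \o g) ->
  closed_box a b `<=` Omega ->
  (forall t, test_function Omega t -> \int[leb]_(x in Omega) (g x * t x) = 0) ->
  (\int[leb]_(x in open_box a b) (g x)%:E)%E = 0%E.
Proof.
move=> mO intg abO g0.
have mg : measurable_fun Omega g.
  by apply/measurable_EFinP; case/integrableP : intg.
have mbump k : measurable_fun Omega (box_bump a b k).
  apply: measurable_fun_continuous => //.
  by have [/(_ [::])[]] := test_function_box_bump _ _ _ k abO.
have bump1 k x : `|box_bump a b k x| <= 1.
  by have /andP[? ?] := box_bump_itv a b k x; rewrite ger0_norm.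
have dom k x : (`|(g x * box_bump a b k x)%:E| <= `|(g x)%:E|)%E.
  by rewrite !abse_EFin lee_fin normrM ler_piMr.
pose G x := ((EFin \o g) \_ (open_box a b)) x.
have boxO : open_box a b `<=` Omega.
  exact: subset_trans (@open_box_sub_closed_box _ _ _ _) abO.
have mG : measurable_fun Omega G.
  apply/(measurable_restrict _ (measurable_open_box a b) mO).
  apply: (measurable_funS mO); first exact: subIsetl.
  exact/measurable_EFinP.
have [|||||_ _] := @dominated_convergence _ _ _ leb Omega mO
    (fun k x => (g x * box_bump a b k x)%:E) G (abse \o (EFin \o g)).
- move=> k; apply/measurable_EFinP; exact: measurable_funM.
- exact: mG.
- apply: aeW => x Ox; rewrite /G patchE; case: ifPn => [|]; last first.
    rewrite notin_setE => /box_bump_out out.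
    by under eq_fun do rewrite out mulr0; exact: cvg_cst.
  rewrite inE => /cvg_box_bump cx; apply: cvg_EFin; first exact: nearW.
  by have := cvgM (cvg_cst (g x)) cx; rewrite mulr1; apply.
- exact: integrable_abse.
- by apply: aeW => x k _; exact: dom.
move=> lim.
have int0 k : (\int[leb]_(x in Omega) (g x * box_bump a b k x)%:E)%E = 0%E.
  have intk : leb.-integrable Omega (EFin \o (fun x => g x * box_bump a b k x)).
    apply: le_integrable intg => // [|x _]; last exact: dom.
    by apply/measurable_EFinP; exact: measurable_funM.
  have := g0 _ (test_function_box_bump Omega a b k abO).
  have /fineK <- := integrable_fin_num mO intk.
  by rewrite /Rintegral => ->.
have limE : (\int[leb]_(x in Omega) G x)%E = 0%E.
  rewrite -(cvg_lim (@ereal_hausdorff R) lim).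
  rewrite (_ : (fun _ => _) = cst 0%E) ?lim_cst//.
  by apply/funext => k; exact: int0.
by rewrite -limE /G -integral_mkcondr setIidr.
Qed.

(** The two previous lemmas apply in each of the countably many boxes that
    exhaust the open set. *)
Lemma ae_eq0_test_function (Omega : set Rd) (g : Rd -> R) :
  open Omega -> leb.-integrable Omega (EFin \o g) ->
  (forall t, test_function Omega t -> \int[leb]_(x in Omega) (g x * t x) = 0) ->
  {ae leb, forall x, Omega x -> g x = 0}.
Proof.
move=> oO intg g0.
have mO := measurable_open _ oO.
have [P [a [b [abO OE]]]] := open_bigcup_box _ oO.
have negk k : leb.-negligible
    [set x | P k /\ open_box (a k) (b k) x /\ g x <> 0].
  have [Pk|nPk] := pselect (P k); last first.
    by apply: negligibleS (negligible_set0 _) => x [].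
  have : ae_eq leb (open_box (a k) (b k)) (EFin \o g) (cst 0%E).
    apply: ae_eq0_open_box => [|a' b' a'b'].
      apply: integrableS intg => //; first exact: measurable_open_box.
      exact: subset_trans (@open_box_sub_closed_box _ _ _ _) (abO k Pk).
    apply: (integral_open_box_eq0 Omega) => //.
    exact: subset_trans a'b' (abO k Pk).
  apply: negligibleS => x [_ [Bx gx0]] /= /(_ Bx)[].
  exact: gx0.
apply: negligibleS (negligible_bigcup negk) => x /= /not_implyP[Ox gx0].
by move: Ox; rewrite OE => -[k Pk Bx]; exists k.
Qed.

End fundamental_lemma.

(** * Square-integrable functions *)

Section square_integrable.
Context {R : realType} {d : nat}.
Local Notation Rd := 'rV[R]_d.
Local Notation leb := (@lebesgue_rV R d).
Context (Omega : set Rd) (mO : measurable Omega).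
Implicit Types u v w : Rd -> R.
Local Notation L2 := (sq_integrable Omega).

(** From [|u v| <= u^2 + v^2]. *)
Lemma integrable_mul u v : L2 u -> L2 v ->
  leb.-integrable Omega (EFin \o (fun x => u x * v x)).
Proof.
move=> [mu iu] [mv iv].
apply: (le_integrable mO _ _ (integrableD mO iu iv)).
  by apply/measurable_EFinP; exact: measurable_funM.
move=> x _; rewrite /= lee_fin [leRHS]ger0_norm; last first.
  by rewrite addr_ge0// sqr_ge0.
by rewrite ler_norml; apply/andP; split; nra.
Qed.

Lemma sq_integrableZ (k : R) u : L2 u -> L2 (fun x => k * u x).
Proof.
move=> [mu iu]; split; first exact: measurable_funM.
rewrite (_ : (fun _ => _) = (fun x => (k ^+ 2)%:E * (u x ^+ 2)%:E)%E).
  exact: integrableZl.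
by apply/funext => x; rewrite -EFinM exprMn.
Qed.

Lemma sq_integrableD u v : L2 u -> L2 v -> L2 (fun x => u x + v x).
Proof.
move=> Lu Lv; have [mu iu] := Lu; have [mv iv] := Lv.
split; first exact: measurable_funD.
have /(integrableZl mO 2) iuv := integrable_mul _ _ Lu Lv.
rewrite (_ : (fun _ => _) = (fun x => (u x ^+ 2)%:E +
    (v x ^+ 2)%:E + 2%:E * (u x * v x)%:E)%E).
  by apply: integrableD => //; exact: integrableD.
by apply/funext => x; rewrite -EFinM -!EFinD; congr (_%:E); ring.
Qed.

Lemma sq_integrableB u v : L2 u -> L2 v -> L2 (fun x => u x - v x).
Proof.
move=> Lu Lv; have := sq_integrableD _ _ Lu (sq_integrableZ (-1) _ Lv).
by congr (L2 _); apply/funext => x; rewrite mulN1r.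
Qed.

Lemma sq_integrable0 : L2 (fun=> 0).
Proof.
split; first exact: measurable_cst.
rewrite (_ : (fun _ => _) = cst 0%E); first exact: integrable0.
by apply/funext => x; rewrite expr0n.
Qed.

Lemma sq_integrable_sum (I : Type) (s : seq I) (f : I -> Rd -> R) :
  (forall i, L2 (f i)) -> L2 (fun x => \sum_(i <- s) f i x).
Proof.
move=> Lf; elim: s => [|i s IHs].
  rewrite (_ : (fun _ => _) = fun=> 0); first exact: sq_integrable0.
  by apply/funext => x; rewrite big_nil.
rewrite (_ : (fun _ => _) = fun x => f i x + \sum_(j <- s) f j x).
  exact: sq_integrableD.
by apply/funext => x; rewrite big_cons.
Qed.

Lemma sq_integrable_bounded_mul (M : R) u v : measurable_fun Omega u ->
  (forall x, `|u x| <= M) -> L2 v -> L2 (fun x => u x * v x).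
Proof.
move=> mu uM [mv iv]; split; first exact: measurable_funM.
apply: (le_integrable mO _ _ (integrableZl mO (M ^+ 2) iv)).
  by apply/measurable_EFinP; apply: measurable_funX; exact: measurable_funM.
move=> x _; rewrite /= lee_fin exprMn normrM [leRHS]normrM ler_wpM2r//.
by rewrite !normrX lerXn2r ?nnegrE// (le_trans (uM x))// ler_norm.
Qed.

Lemma ipC u v : ip Omega u v = ip Omega v u.
Proof. by apply: eq_Rintegral => x _; rewrite mulrC. Qed.

Lemma ip_ge0 u : 0 <= ip Omega u u.
Proof. by apply: Rintegral_ge0 => x _; rewrite -expr2 sqr_ge0. Qed.

Lemma l2norm_sqr u : l2norm Omega u ^+ 2 = ip Omega u u.
Proof. by rewrite sqr_sqrtr// ip_ge0. Qed.

Lemma ipDl u v w : L2 u -> L2 v -> L2 w ->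
  ip Omega (fun x => u x + v x) w = ip Omega u w + ip Omega v w.
Proof.
move=> Lu Lv Lw.
rewrite -[RHS]RintegralD//; [|exact: integrable_mul|exact: integrable_mul].
by apply: eq_Rintegral => x _; rewrite mulrDl.
Qed.

Lemma ipZl k u v : L2 u -> L2 v ->
  ip Omega (fun x => k * u x) v = k * ip Omega u v.
Proof.
move=> Lu Lv; rewrite -[RHS]RintegralZl//; last exact: integrable_mul.
by apply: eq_Rintegral => x _; rewrite mulrA.
Qed.

Lemma ipDr u v w : L2 u -> L2 v -> L2 w ->
  ip Omega u (fun x => v x + w x) = ip Omega u v + ip Omega u w.
Proof. by move=> Lu Lv Lw; rewrite !(ipC u) ipDl. Qed.

Lemma ipZr k u v : L2 u -> L2 v ->
  ip Omega u (fun x => k * v x) = k * ip Omega u v.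
Proof. by move=> Lu Lv; rewrite !(ipC u) ipZl. Qed.

Lemma ipBl u v w : L2 u -> L2 v -> L2 w ->
  ip Omega (fun x => u x - v x) w = ip Omega u w - ip Omega v w.
Proof.
move=> Lu Lv Lw; rewrite -[- ip _ v w]mulN1r -ipZl// -ipDl//.
  by apply: eq_Rintegral => x _; rewrite mulN1r.
exact: sq_integrableZ.
Qed.

Lemma ipBr u v w : L2 u -> L2 v -> L2 w ->
  ip Omega u (fun x => v x - w x) = ip Omega u v - ip Omega u w.
Proof. by move=> Lu Lv Lw; rewrite !(ipC u) ipBl. Qed.

Lemma eq_ip_ae u u' v : L2 u -> L2 u' -> L2 v ->
  {ae leb, forall x, Omega x -> u x = u' x} -> ip Omega u v = ip Omega u' v.
Proof.
move=> [mu _] [mu' _] [mv _] uu'; congr fine; apply: ae_eq_integral => //.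
- by apply/measurable_EFinP; exact: measurable_funM.
- by apply/measurable_EFinP; exact: measurable_funM.
- by apply: filterS uu' => x /= uu' /uu' ->.
Qed.

(** The discrete counterpart of [2 u u' = (u^2)'], with the quadratic error of
    the backward difference kept. *)
Lemma ip_backward_difference (tau : R) u v w : L2 u -> L2 v -> L2 w ->
  {ae leb, forall x, Omega x -> v x = u x - tau * w x} ->
  2 * tau * ip Omega w u =
  ip Omega u u - ip Omega v v + tau ^+ 2 * ip Omega w w.
Proof.
move=> Lu Lv Lw vE.
have Lt := sq_integrableZ tau _ Lw; have Lut := sq_integrableB _ _ Lu Lt.
have -> : ip Omega v v = ip Omega (fun x => u x - tau * w x)
    (fun x => u x - tau * w x).
  by rewrite (eq_ip_ae v _ v Lv Lut Lv vE) ipC; exact: eq_ip_ae.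
rewrite ipBl// !ipBr// !ipZl// !ipZr// (ipC u w); ring.
Qed.

(** The hypothesis holds when [w] is the orthogonal projection of [- c v] on
    some space; a projection does not increase the norm. *)
Lemma ip_projection_le (c : R) v w : L2 v -> L2 w ->
  ip Omega w w = - c * ip Omega v w -> ip Omega w w <= c ^+ 2 * ip Omega v v.
Proof.
move=> Lv Lw ww; have Lc := sq_integrableZ c _ Lv.
have := ip_ge0 (fun x => w x + c * v x).
rewrite ipDl//; last exact: sq_integrableD.
rewrite !ipDr// !ipZl// !ipZr// (ipC w v); nra.
Qed.

Definition mx_sq_integrable {m n} (F : Rd -> 'M[R]_(m, n)) :=
  forall i j, L2 (fun x => F x i j).

Lemma ipm_ge0 m n (F : Rd -> 'M[R]_(m, n)) : 0 <= ipm Omega F F.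
Proof.
apply: Rintegral_ge0 => x _; apply: sumr_ge0 => i _; apply: sumr_ge0 => j _.
by rewrite -expr2 sqr_ge0.
Qed.

Lemma l2normm_sqr m n (F : Rd -> 'M[R]_(m, n)) :
  l2normm Omega F ^+ 2 = ipm Omega F F.
Proof. by rewrite sqr_sqrtr// ipm_ge0. Qed.

Lemma ipmC m n (F G : Rd -> 'M[R]_(m, n)) : ipm Omega F G = ipm Omega G F.
Proof.
apply: eq_Rintegral => x _; apply: eq_bigr => i _; apply: eq_bigr => j _.
exact: mulrC.
Qed.

Lemma Rintegral_sum (I : Type) (s : seq I) (f : I -> Rd -> R) :
  (forall i, leb.-integrable Omega (EFin \o f i)) ->
  \int[leb]_(x in Omega) (\sum_(i <- s) f i x) =
  \sum_(i <- s) \int[leb]_(x in Omega) f i x.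
Proof.
move=> intf; elim: s => [|i s IHs].
  rewrite big_nil (@eq_Rintegral _ _ _ leb Omega (cst 0)) => [|x _].
    by rewrite /Rintegral integral0.
  by rewrite big_nil.
rewrite big_cons -IHs -RintegralD//.
  by apply: eq_Rintegral => x _; rewrite big_cons.
rewrite (_ : _ \o _ = fun x => (\sum_(j <- s) (EFin \o f j) x)%E).
  exact: integrable_sum.
by apply/funext => x; rewrite /= sumEFin.
Qed.

Lemma ipm_sum m n (F G : Rd -> 'M[R]_(m, n)) :
  mx_sq_integrable F -> mx_sq_integrable G ->
  ipm Omega F G =
  \sum_i \sum_j ip Omega (fun x => F x i j) (fun x => G x i j).
Proof.
move=> LF LG; rewrite /ipm Rintegral_sum => [|i].
  by apply: eq_bigr => i _; rewrite Rintegral_sum// => j; exact: integrable_mul.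
rewrite (_ : _ \o _ = fun x => (\sum_j (F x i j * G x i j)%:E)%E).
  by apply: integrable_sum => // j _; exact: integrable_mul.
by apply/funext => x; rewrite /= sumEFin.
Qed.

Lemma ipm_backward_difference m n (tau : R) (F G H : Rd -> 'M[R]_(m, n)) :
  mx_sq_integrable F -> mx_sq_integrable G -> mx_sq_integrable H ->
  (forall i j, {ae leb, forall x, Omega x -> G x i j = F x i j - tau * H x i j}) ->
  2 * tau * ipm Omega H F =
  ipm Omega F F - ipm Omega G G + tau ^+ 2 * ipm Omega H H.
Proof.
move=> LF LG LH GE; rewrite !ipm_sum// !mulr_sumr -sumrB -big_split/=.
apply: eq_bigr => i _; rewrite !mulr_sumr -sumrB -big_split/=.
by apply: eq_bigr => j _; apply: ip_backward_difference.
Qed.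

End square_integrable.

(** * Weak derivatives *)

Section weak_gradient.
Context {R : realType} {d : nat}.
Local Notation Rd := 'rV[R]_d.
Local Notation leb := (@lebesgue_rV R d).
Context (Omega : set Rd) (oO : open Omega) (bO : bounded_set Omega).
Implicit Types u v w g h : Rd -> R.
Local Notation L2 := (sq_integrable Omega).

Let mO : measurable Omega. Proof. exact: measurable_open. Qed.

(** A bounded set lies in a compact box, on which the function is bounded, and
    has finite measure. *)
Lemma continuous_sq_integrable (f : Rd -> R) : continuous f -> L2 f.
Proof.
move=> cf; have mf : measurable_fun Omega f by exact: measurable_fun_continuous.
split=> //.
have [r Or] := bounded_sub_open_box _ _ bO.
have := compact_closed_box (const_mx (- r) : Rd) (const_mx r).
move=> /(continuous_compact (continuous_subspaceT cf))/compact_bounded[M [Mr fM]].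
apply: (@measurable_bounded_integrable _ _ _ leb (fun x => f x ^+ 2)) => //.
- exact: lebesgue_rV_bounded_lty.
- exact: measurable_funX.
exists ((`|M| + 1) ^+ 2); split; first exact: num_real.
move=> N MN x Ox /=; rewrite (le_trans _ (ltW MN))// normrX.
rewrite lerXn2r ?nnegrE// ?addr_ge0//; apply: (fM (`|M| + 1)).
  by rewrite (le_lt_trans (ler_norm _))// ltrDl.
by exists x => //; exact/open_box_sub_closed_box/Or.
Qed.

Lemma test_function_sq_integrable (t : Rd -> R) :
  test_function Omega t -> L2 t.
Proof. by move=> [st _ _]; apply: continuous_sq_integrable; have [] := st [::]. Qed.

Lemma partial_test_function_sq_integrable (i : 'I_d) (t : Rd -> R) :
  test_function Omega t -> L2 (partial i t).
Proof. by move=> [st _ _]; apply: continuous_sq_integrable; have [] := st [:: i]. Qed.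

Lemma sq_integrable_integrable u : L2 u -> leb.-integrable Omega (EFin \o u).
Proof.
move=> Lu; have L1 : L2 (cst 1).
  by apply: continuous_sq_integrable => x; exact: cst_continuous.
have := integrable_mul _ mO _ _ Lu L1.
by congr (integrable _ _ _); apply/funext => x; rewrite /= mulr1.
Qed.

Lemma weak_partial_lincomb (i : 'I_d) (a b : R) u v g h :
  L2 u -> L2 v -> L2 g -> L2 h ->
  weak_partial Omega i u g -> weak_partial Omega i v h ->
  weak_partial Omega i (fun x => a * u x + b * v x)
    (fun x => a * g x + b * h x).
Proof.
move=> Lu Lv Lg Lh ug vh t Tt.
have Lt := test_function_sq_integrable _ Tt.
have Lp := partial_test_function_sq_integrable i _ Tt.
have Lau := sq_integrableZ _ mO a _ Lu; have Lbv := sq_integrableZ _ mO b _ Lv.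
have Lag := sq_integrableZ _ mO a _ Lg; have Lbh := sq_integrableZ _ mO b _ Lh.
have := ug t Tt; have := vh t Tt.
rewrite -!/(ip Omega _ _) ipDl// !ipZl// ipDl// !ipZl// => -> ->; ring.
Qed.

Lemma weak_partial_uniq (i : 'I_d) u g h : L2 g -> L2 h ->
  weak_partial Omega i u g -> weak_partial Omega i u h ->
  {ae leb, forall x, Omega x -> g x = h x}.
Proof.
move=> Lg Lh ug uh.
have gh0 : {ae leb, forall x, Omega x -> g x - h x = 0}.
  apply: ae_eq0_test_function => // [|t Tt].
    by apply: sq_integrable_integrable; exact: sq_integrableB.
  have Lt := test_function_sq_integrable _ Tt.
  rewrite -/(ip Omega _ _) ipBl//; apply/eqP; rewrite subr_eq0 -eqr_opp.
  by rewrite -(ug t Tt) -(uh t Tt).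
by apply: filterS gh0 => x gh0 /gh0/eqP; rewrite subr_eq0 => /eqP.
Qed.

Lemma wDP (i : 'I_d) u : H1 Omega u ->
  L2 (wD Omega i u) /\ weak_partial Omega i u (wD Omega i u).
Proof.
move=> [_ /(_ i)] exg.
exact: (xgetPex (fun=> 0) exg).
Qed.

Lemma H1_lincomb (a b : R) u v : H1 Omega u -> H1 Omega v ->
  H1 Omega (fun x => a * u x + b * v x).
Proof.
move=> Hu Hv; have [Lu _] := Hu; have [Lv _] := Hv; split.
  by apply: sq_integrableD => //; exact: sq_integrableZ.
move=> i; have [Lg ug] := wDP i _ Hu; have [Lh vh] := wDP i _ Hv.
exists (fun x => a * wD Omega i u x + b * wD Omega i v x); split.
  by apply: sq_integrableD => //; exact: sq_integrableZ.
exact: weak_partial_lincomb.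
Qed.

(** The representatives chosen for the three weak derivatives are unrelated, so
    linearity is only an almost everywhere statement; it rests on
    uniqueness. *)
Lemma wD_lincomb (i : 'I_d) (a b : R) u v : H1 Omega u -> H1 Omega v ->
  {ae leb, forall x, Omega x ->
    wD Omega i (fun y => a * u y + b * v y) x =
    a * wD Omega i u x + b * wD Omega i v x}.
Proof.
move=> Hu Hv; have [Lu _] := Hu; have [Lv _] := Hv.
have [Lg ug] := wDP i _ Hu; have [Lh vh] := wDP i _ Hv.
have [Lw uw] := wDP i _ (H1_lincomb a b _ _ Hu Hv).
apply: (weak_partial_uniq i _ _ _ Lw _ uw).
  by apply: sq_integrableD => //; exact: sq_integrableZ.
exact: weak_partial_lincomb.
Qed.

(** The form in which [wD_lincomb] meets [ip_backward_difference]. *)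
Lemma wD_backward_difference (i : 'I_d) (tau : R) u v : tau != 0 ->
  H1 Omega u -> H1 Omega v ->
  {ae leb, forall x, Omega x -> wD Omega i v x =
    wD Omega i u x - tau * wD Omega i (fun y => tau^-1 * (u y - v y)) x}.
Proof.
move=> tau0 Hu Hv; have := wD_lincomb i tau^-1 (- tau^-1) _ _ Hu Hv.
rewrite (_ : (fun y => _) = fun y => tau^-1 * (u y - v y)); last first.
  by apply/funext => y; rewrite mulrBr mulNr.
by apply: filterS => x wE /wE ->; field.
Qed.

Lemma diver_sq_integrable (w : Rd -> Rd) :
  (forall i, H1 Omega (vcomp w i)) -> L2 (diver Omega w).
Proof.
move=> Hw; apply: sq_integrable_sum => // i.
by have [] := wDP i _ (Hw i).
Qed.

Lemma grad_sq_integrable u : H1 Omega u -> mx_sq_integrable Omega (grad Omega u).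
Proof.
move=> Hu i j; have [Lg _] := wDP j _ Hu.
by congr (L2 _): Lg; apply/funext => x; rewrite mxE.
Qed.

Lemma diver_backward_difference (tau : R) (u v : Rd -> Rd) : tau != 0 ->
  (forall i, H1 Omega (vcomp u i)) -> (forall i, H1 Omega (vcomp v i)) ->
  {ae leb, forall x, Omega x -> diver Omega v x =
    diver Omega u x - tau * diver Omega (fun y => tau^-1 *: (u y - v y)) x}.
Proof.
move=> tau0 Hu Hv.
have := @filter_forall _ _ _ _ (ae_filter_ringOfSetsType leb)
  (fun i => wD_backward_difference i tau _ _ tau0 (Hu i) (Hv i)).
apply: filterS => x wE Ox; rewrite /diver mulr_sumr -sumrB.
apply: eq_bigr => i _; rewrite wE//; congr (_ - _ * wD Omega i _ x).
by apply/funext => y; rewrite /vcomp !mxE.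
Qed.

End weak_gradient.

(** * Coefficients of the scheme and the algebra of its energy *)

Section coefficients.
Context {R : realType}.
Implicit Types (p : parameters R) (x : R).

Lemma cutoffE x : cutoff x = Num.max (-1) (Num.min x 1).
Proof.
have N11 : -1 <= 1 :> R by lra.
rewrite /cutoff ler_norml; case: ifPn => [/andP[x1 x2]|].
  by rewrite min_l// max_r.
rewrite negb_and -!ltNge => /orP[x1|x1].
  by rewrite ltr0_sg ?min_l ?max_l//; lra.
by rewrite gtr0_sg ?min_r ?max_r//; lra.
Qed.

Lemma cutoff_itv x : -1 <= cutoff x <= 1.
Proof.
have N11 : -1 <= 1 :> R by lra.
by rewrite cutoffE le_max lexx/= ge_max N11/= ge_min lexx orbT.
Qed.

Lemma measurable_cutoff : measurable_fun [set: R] (@cutoff R).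
Proof.
rewrite (_ : @cutoff R = cst (-1) \max (idfun \min cst 1)).
  apply: measurable_maxr; first exact: measurable_cst.
  by apply: measurable_minr; [exact: measurable_id|exact: measurable_cst].
by apply/funext => x; rewrite cutoffE.
Qed.

Lemma measurable_sigma p : measurable_fun [set: R] (sigma p).
Proof.
rewrite -[sigma p]/(Num.sqrt \o density p).
apply: measurableT_comp.
  by apply: continuous_measurable_fun; exact: sqrt_continuous.
apply: measurable_funD => //; apply: measurable_funM => //.
exact: measurable_cutoff.
Qed.

Lemma sigma_bounded p : exists M : R, forall x, `|sigma p x| <= M.
Proof.
pose a := (rho1 p - rho2 p) / (2 * rhor p).
pose b := (rho1 p + rho2 p) / (2 * rhor p).
exists (Num.sqrt (`|a| + b)) => x.
rewrite ger0_norm ?sqrtr_ge0// /sigma ler_wsqrtr// /density -/a -/b lerD2r.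
rewrite (le_trans (ler_norm _))// normrM ler_piMr// ler_norml.
exact: cutoff_itv.
Qed.

Lemma viscosity_ge0 p x : admissible p -> 0 <= viscosity p x.
Proof.
move=> [_ [_ _ e1 e2] [_ er _ _] _ _].
have -> : viscosity p x =
    (eta1 p * (1 + cutoff x) + eta2 p * (1 - cutoff x)) / (2 * etar p).
  by rewrite /viscosity; field; rewrite gt_eqF.
have /andP[c1 c2] := cutoff_itv x.
rewrite divr_ge0//; last by rewrite mulr_ge0// ltW.
by rewrite addr_ge0// mulr_ge0 ?(ltW e1) ?(ltW e2)//; lra.
Qed.

Lemma varrho_gt0 p : admissible p -> 0 < varrho p.
Proof.
by move=> [_ [r1 r2 _ _] [rr _ _ _] _ _]; rewrite divr_gt0// lt_min r1.
Qed.

End coefficients.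

Lemma finite_dim_lincomb {R : realType} d (E : lmodType R)
    (V : set ('rV[R]_d -> E)) (a b : R) u v :
  finite_dim V -> V u -> V v -> V (fun x => a *: u x + b *: v x).
Proof.
move=> [n [e ->]] [c ->] [c' ->]; exists (fun i => a * c i + b * c' i).
apply/funext => x; rewrite !scaler_sumr -big_split/=.
by apply: eq_bigr => i _; rewrite scalerDl !scalerA.
Qed.

Lemma finite_dimB {R : realType} d (E : lmodType R)
    (V : set ('rV[R]_d -> E)) u v :
  finite_dim V -> V u -> V v -> V (u - v).
Proof.
move=> fV Vu Vv; have := finite_dim_lincomb _ _ _ 1 (-1) _ _ fV Vu Vv.
by congr V; apply/funext => x; rewrite scale1r scaleN1r.
Qed.

(** The tested equations of one step, combined with the weights [1],
    [1 / (we cn)], [2 / (we cn)] and [1]. With these weights every term in [xi1]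
    and [xi2] occurs once with each sign, which is the purpose of the two
    auxiliary variables, and the squares of increments are only discarded where
    they help. The square [b2] of the divergence is kept, since the pressure will
    consume it. *)
Lemma energy_balance_algebra {R : realFieldType}
    {tau zt cn pe rey we s T xi1 xi2 a0 a1 a2 b0 b1 b2 c0 c1 c2 e0 e1 e2
     r0 r1 q0 q1 W X Y Z K B Pd : R} :
  0 < cn -> 0 < we -> 0 < s -> pe != 0 -> rey != 0 -> T != 0 ->
  0 <= a2 -> 0 <= c2 -> 0 <= e2 ->
  a1 - a0 + tau ^+ 2 * a2 + zt * (b1 - b0 + tau ^+ 2 * b2) +
    2 * tau * (2 / rey * W) =
    2 * tau * (- (xi2 / 2) * B + Pd - xi1 / (we * cn) * K) ->
  cn ^+ 2 * (c1 - c0 + tau ^+ 2 * c2) + s * (e1 - e0 + tau ^+ 2 * e2) +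
    2 * tau * (xi1 * Z) = 2 * tau * (xi1 * Y - pe^-1 * X) ->
  2 * r1 * (r1 - r0) = tau * (xi1 * (Z - Y + K)) ->
  2 * q1 * (q1 - q0) = tau * (- (2 * (q1 ^+ 2 / T)) + xi2 * B) ->
  (a1 + cn / we * c1 + s / (we * cn) * e1 + 2 / (we * cn) * r1 ^+ 2 +
     q1 ^+ 2 + zt * b1) +
  tau * (4 / rey * W + 2 / T * q1 ^+ 2 + 2 / (pe * we * cn) * X) +
  zt * (tau ^+ 2 * b2) <=
  (a0 + cn / we * c0 + s / (we * cn) * e0 + 2 / (we * cn) * r0 ^+ 2 +
     q0 ^+ 2 + zt * b0) + 2 * tau * Pd.
Proof.
move=> cn0 we0 s0 pe0 rey0 T0 a20 c20 e20 HM HP HR HQ.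
rewrite -subr_ge0.
have t20 : 0 <= tau ^+ 2 by rewrite sqr_ge0.
have cw : 0 < (we * cn)^-1 by rewrite invr_gt0 mulr_gt0.
apply: (@le_trans _ _ (tau ^+ 2 * a2 +
   (we * cn)^-1 * (cn ^+ 2 * (tau ^+ 2 * c2) + s * (tau ^+ 2 * e2)) +
   2 * (we * cn)^-1 * (r1 - r0) ^+ 2 + (q1 - q0) ^+ 2)).
  have cw0 := ltW cw; have s0' := ltW s0.
  have A2 := mulr_ge0 t20 a20; have C2 := mulr_ge0 t20 c20.
  have E2 := mulr_ge0 s0' (mulr_ge0 t20 e20).
  have CC2 := mulr_ge0 (sqr_ge0 cn) C2.
  have R2 := mulr_ge0 (mulr_ge0 (ler0n _ 2) cw0) (sqr_ge0 (r1 - r0)).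
  exact: addr_ge0 (addr_ge0 (addr_ge0 A2 (mulr_ge0 cw0 (addr_ge0 CC2 E2))) R2)
    (sqr_ge0 _).
rewrite le_eqVlt; apply/orP; left; apply/eqP.
have wecn : we * cn != 0 by rewrite mulf_neq0// gt_eqF.
have HP' := congr1 (fun t => t / (we * cn)) HP.
have HR' := congr1 (fun t => 2 / (we * cn) * t) HR.
have we0' : we != 0 by rewrite gt_eqF.
have cn0' : cn != 0 by rewrite gt_eqF.
rewrite /= in HP' HR'.
have S : (a1 - a0 + tau ^+ 2 * a2 + zt * (b1 - b0 + tau ^+ 2 * b2) +
    2 * tau * (2 / rey * W) -
    2 * tau * (- (xi2 / 2) * B + Pd - xi1 / (we * cn) * K)) +
   ((cn ^+ 2 * (c1 - c0 + tau ^+ 2 * c2) + s * (e1 - e0 + tau ^+ 2 * e2) +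
    2 * tau * (xi1 * Z)) / (we * cn) -
    2 * tau * (xi1 * Y - pe^-1 * X) / (we * cn)) +
   (2 / (we * cn) * (2 * r1 * (r1 - r0)) -
    2 / (we * cn) * (tau * (xi1 * (Z - Y + K)))) +
   (2 * q1 * (q1 - q0) - tau * (- (2 * (q1 ^+ 2 / T)) + xi2 * B)) = 0.
  by rewrite HM HP' HR' HQ !subrr !addr0.
apply/eqP; rewrite -subr_eq0 -[X in _ == X]S; apply/eqP.
by field; rewrite we0' cn0' pe0 rey0 T0.
Qed.

(** The grad-div dissipation [zt * b] absorbs the part [k * b] of the pressure
    pairing [pr]; the part [x] is zero except in the first step, where it comes
    from the initial divergence. *)
Lemma energy_step_algebra {R : realFieldType}
    (E1 E0 D c s0 s1 pr x k b zt : R) :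
  E1 + D + zt * b <= E0 + pr -> pr <= c * (s0 - s1) + x + k * b -> 0 <= b ->
  k <= zt -> E1 + c * s1 + D <= E0 + c * s0 + x.
Proof. by move=> bal prs b0 kz; have := ler_wpM2r b0 kz; lra. Qed.

(** * The discrete energy law *)

Section scheme_energy.
Context {R : realType} {d : nat}.
Local Notation Rd := 'rV[R]_d.
Local Notation leb := (@lebesgue_rV R d).
Context (Omega : set Rd) (oO : open Omega) (bO : bounded_set Omega).
Context (p : parameters R) (adm : admissible p).
Context (F : fe_spaces R d).
Context (finV : finite_dim (E := R^o) (Vh F)) (finX : finite_dim (Xh F))
  (finN : finite_dim (E := R^o) (Nh F)).
Context (H1V : forall u, Vh F u -> H1 Omega u)
  (H1X : forall w, Xh F w -> forall i, H1 Omega (vcomp w i))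
  (H1N : forall q, Nh F q -> H1 Omega q).
Context (tau : R) (tau_gt0 : 0 < tau) (z : trajectory R d).

Let mO : measurable Omega. Proof. exact: measurable_open. Qed.
Let tau_neq0 : tau != 0. Proof. by rewrite gt_eqF. Qed.

Definition in_spaces n := [/\ Vh F (phase z n), Vh F (chempot z n),
  Xh F (vel z n) & Nh F (pres z n)].

(** The energy without its pressure term, which does not come from testing the
    equations of a single step but from the telescoping of the pressure
    coupling. *)
Definition bulk_energy n : R :=
  l2normm Omega (sigmau p z n) ^+ 2 +
  Cn p / We p * l2normm Omega (grad Omega (phase z n)) ^+ 2 +
  stab p / (We p * Cn p) * l2norm Omega (phase z n) ^+ 2 +
  2 / (We p * Cn p) * `|Rv z n| ^+ 2 +
  `|Qv z n| ^+ 2 +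
  zeta p * l2norm Omega (diver Omega (vel z n)) ^+ 2.

Lemma dtau_vel_in_space n : Xh F (vel z n) -> Xh F (vel z n.+1) ->
  Xh F (dtau tau (vel z) n.+1).
Proof.
move=> Xu0 Xu1.
have := finite_dim_lincomb _ _ _ tau^-1 (- tau^-1) _ _ finX Xu1 Xu0.
congr (Xh F _); apply/funext => x.
by rewrite /dtau -[RHS]/(tau^-1 *: (_ - _)) scalerBr scaleNr.
Qed.

Lemma bulk_energyE n : bulk_energy n =
  ipm Omega (sigmau p z n) (sigmau p z n) +
  Cn p / We p * ipm Omega (grad Omega (phase z n)) (grad Omega (phase z n)) +
  stab p / (We p * Cn p) * ip Omega (phase z n) (phase z n) +
  2 / (We p * Cn p) * Rv z n ^+ 2 + Qv z n ^+ 2 +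
  zeta p * ip Omega (diver Omega (vel z n)) (diver Omega (vel z n)).
Proof.
by congr (_ + _ * _ + _ * _ + _ * _ + _ + _ * _);
  rewrite ?real_normK ?num_real//;
  [exact: l2normm_sqr|exact: l2normm_sqr|exact: l2norm_sqr|exact: l2norm_sqr].
Qed.

Lemma dissipationE n : dissipation p Omega z n.+1 =
  4 / Rey p * l2normm Omega (fun x => Num.sqrt (viscosity p (phase z n x)) *:
                                      symgrad Omega (vel z n.+1) x) ^+ 2 +
  2 / tfin p * Qv z n.+1 ^+ 2 +
  2 / (Pe p * We p * Cn p) *
    ipm Omega (grad Omega (chempot z n.+1)) (grad Omega (chempot z n.+1)).
Proof.
congr (_ + _ * _ + _ * _); first exact: real_normK (num_real _).
exact: l2normm_sqr.
Qed.

Lemma sigmau_sq_integrable n : Vh F (extrap (phase z) n) -> Xh F (vel z n) ->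
  mx_sq_integrable Omega (sigmau p z n).
Proof.
move=> Vphi Xu i j; have [M sM] := sigma_bounded p.
have [[mphi _] _] := H1V _ Vphi; have [Lu _] := H1X _ Xu j.
have := sq_integrable_bounded_mul Omega mO M (sigmat p z n) _ _ _ Lu.
rewrite (_ : (fun x => _) = fun x => sigmau p z n x i j); last first.
  by apply/funext => x; rewrite /sigmau mxE (ord1 i).
apply=> [|x]; last exact: sM.
exact: measurableT_comp (measurable_sigma p) mphi.
Qed.

Lemma force_ipm_eq0 n (v : Rd -> Rd) :
  (forall i, sq_integrable Omega (vcomp (force z n) i)) ->
  {ae leb, forall x, Omega x -> force z n x = 0} ->
  (forall i, sq_integrable Omega (vcomp v i)) ->
  ipm Omega (force z n) v = 0.
Proof.
move=> Lf f0 Lv.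
have Lm (w : Rd -> Rd) : (forall i, sq_integrable Omega (vcomp w i)) ->
    mx_sq_integrable Omega w by move=> Lw i j; rewrite (ord1 i); exact: Lw.
rewrite ipm_sum//; [|exact: Lm|exact: Lm].
rewrite big1// => i _; rewrite big1// => j _; rewrite (ord1 i).
have L0 := sq_integrable0 Omega.
rewrite (eq_ip_ae _ mO _ (fun=> 0) _ (Lf j) L0 (Lv j)).
  rewrite /ip (@eq_Rintegral _ _ _ leb Omega (cst 0)) => [|x _].
    by rewrite /Rintegral integral0.
  by rewrite mul0r.
by apply: filterS f0 => x f0 /f0; rewrite /vcomp => ->; rewrite mxE.
Qed.

(** Tests the phase equation with the new potential, the potential equation
    with the difference quotient of [phi] and the momentum equation with the new
    velocity. *)
Lemma energy_balance n : (forall k, (k <= n.+1)%N -> in_spaces k) ->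
  AC_step p Omega tau z F n.+1 ->
  (forall i, sq_integrable Omega (vcomp (force z n.+1) i)) ->
  {ae leb, forall x, Omega x -> force z n.+1 x = 0} ->
  bulk_energy n.+1 + tau * dissipation p Omega z n.+1 +
    zeta p * (tau ^+ 2 * ip Omega (diver Omega (dtau tau (vel z) n.+1))
                                  (diver Omega (dtau tau (vel z) n.+1))) <=
  bulk_energy n +
    2 * tau * ip Omega (Psharp z n) (diver Omega (vel z n.+1)).
Proof.
move=> Sp [_ [Hphase Hpot] HR [Hmom _] HQ] Lf f0.
have [Vphi1 Vmu1 Xu1 _] := Sp n.+1 (leqnn _).
have [Vphi0 Vmu0 Xu0 _] := Sp n (leqnSn _).
have [Vphim _ _ _] := Sp n.-1 (leq_trans (leq_pred n) (leqnSn n)).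
have := adm; case=> -[cn0 pe0 rey0 we0 _] _ [_ _ s0 _] T0 _.
have Vdphi : Vh F (dphi tau z n.+1).
  have := finite_dim_lincomb _ _ _ tau^-1 (- tau^-1) _ _ finV Vphi1 Vphi0.
  congr (Vh F _); apply/funext => x.
  by rewrite -[LHS]/(tau^-1 * _ + - tau^-1 * _) mulNr -mulrBr.
have {}Hphase := Hphase _ Vmu1; have {}Hpot := Hpot _ Vdphi.
have {}Hmom := Hmom _ Xu1.
rewrite force_ipm_eq0// ?mulr0 ?addr0 in Hmom; last first.
  by move=> i; have [] := H1X _ Xu1 i.
have Xdu := dtau_vel_in_space _ Xu0 Xu1.
have Hdphi : H1 Omega (dphi tau z n.+1) by exact: H1V.
(* the factor [sigma] of the inertial term is moved onto the test function,
   turning it into the weighted velocity of the new level *)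
have Ls1 : mx_sq_integrable Omega (sigmau p z n.+1).
  exact: sigmau_sq_integrable.
have Ls0 : mx_sq_integrable Omega (sigmau p z n).
  exact: sigmau_sq_integrable.
have Lds : mx_sq_integrable Omega (dtau tau (sigmau p z) n.+1).
  move=> i j; have := sq_integrableZ _ mO tau^-1 _
    (sq_integrableB _ mO _ _ (Ls1 i j) (Ls0 i j)).
  by congr (sq_integrable _ _); apply/funext => x; rewrite !mxE.
have Ea := ipm_backward_difference _ mO _ _ tau _ _ _ Ls1 Ls0 Lds.
have {}Ea : 2 * tau * ipm Omega
      (fun x => sigmat p z n.+1 x *: dtau tau (sigmau p z) n.+1 x)
      (vel z n.+1) =
    ipm Omega (sigmau p z n.+1) (sigmau p z n.+1) -
    ipm Omega (sigmau p z n) (sigmau p z n) +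
    tau ^+ 2 * ipm Omega (dtau tau (sigmau p z) n.+1)
                         (dtau tau (sigmau p z) n.+1).
  rewrite -Ea => [|i j]; last by apply: aeW => x _; rewrite !mxE; field.
  congr (_ * _); apply: eq_Rintegral => x _.
  by apply: eq_bigr => i _; apply: eq_bigr => j _; rewrite !mxE; ring.
have Eb := ip_backward_difference _ mO tau _ _ _
  (diver_sq_integrable _ oO _ (H1X _ Xu1))
  (diver_sq_integrable _ oO _ (H1X _ Xu0)) 
  (diver_sq_integrable _ oO _ (H1X _ Xdu))
  (diver_backward_difference _ oO bO tau _ _ tau_neq0 (H1X _ Xu1) (H1X _ Xu0)).
have Ec : 2 * tau * ipm Omega (grad Omega (dphi tau z n.+1))
      (grad Omega (phase z n.+1)) =
    ipm Omega (grad Omega (phase z n.+1)) (grad Omega (phase z n.+1)) -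
    ipm Omega (grad Omega (phase z n)) (grad Omega (phase z n)) +
    tau ^+ 2 * ipm Omega (grad Omega (dphi tau z n.+1))
                         (grad Omega (dphi tau z n.+1)).
  apply: ipm_backward_difference => //; [exact: grad_sq_integrable (H1V _ _)..|].
  move=> i j.
  have := wD_backward_difference _ oO bO j tau _ _ tau_neq0 (H1V _ Vphi1)
    (H1V _ Vphi0).
  by apply: filterS => x wE Ox; rewrite !mxE wE.
have Ee : 2 * tau * ip Omega (dphi tau z n.+1) (phase z n.+1) =
    ip Omega (phase z n.+1) (phase z n.+1) - ip Omega (phase z n) (phase z n) +
    tau ^+ 2 * ip Omega (dphi tau z n.+1) (dphi tau z n.+1).
  apply: ip_backward_difference => //; [by have [] := H1V _ Vphi1|
    by have [] := H1V _ Vphi0|by have [] := Hdphi|].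
  apply: aeW => x _; rewrite /dphi /dtau.
  by rewrite -[X in _ - _ * X]/(tau^-1 * (phase z n.+1 x - phase z n x)); field.
have Evisc : ipm Omega (fun x => etat p z n.+1 x *: symgrad Omega (vel z n.+1) x)
      (symgrad Omega (vel z n.+1)) =
    l2normm Omega (fun x => Num.sqrt (viscosity p (phase z n x)) *:
                          symgrad Omega (vel z n.+1) x) ^+ 2.
  rewrite l2normm_sqr; apply: eq_Rintegral => x _.
  apply: eq_bigr => i _; apply: eq_bigr => j _.
  rewrite [in LHS]mxE [in RHS]mxE mulrACA -expr2 sqr_sqrtr ?viscosity_ge0//.
  by rewrite -mulrA.
rewrite Evisc in Hmom.
have pe0' : Pe p != 0 by rewrite gt_eqF.
have rey0' : Rey p != 0 by rewrite gt_eqF.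
have T0' : tfin p != 0 by rewrite gt_eqF.
rewrite -/(dtau tau (vel z) n.+1) in Eb.
have HM := congr1 (fun t => 2 * tau * t) Hmom.
rewrite /= mulrDr mulrDr [2 * tau * (zeta p * _)]mulrCA Ea Eb in HM.
have HP : Cn p ^+ 2 * (ipm Omega (grad Omega (phase z n.+1)) (grad Omega (phase z n.+1)) -
    ipm Omega (grad Omega (phase z n)) (grad Omega (phase z n)) +
    tau ^+ 2 * ipm Omega (grad Omega (dphi tau z n.+1))
                         (grad Omega (dphi tau z n.+1))) +
  stab p * (ip Omega (phase z n.+1) (phase z n.+1) - ip Omega (phase z n) (phase z n) +
    tau ^+ 2 * ip Omega (dphi tau z n.+1) (dphi tau z n.+1)) +
  2 * tau * (xi1 p Omega z n.+1 * ip Omega (dGpot p z n.+1) (dphi tau z n.+1)) =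
  2 * tau * (xi1 p Omega z n.+1 * ipm Omega (phiu z n.+1) (grad Omega (chempot z n.+1)) -
  (Pe p)^-1 *
  ipm Omega (grad Omega (chempot z n.+1)) (grad Omega (chempot z n.+1))).
  rewrite ipC Hphase [ip Omega (phase _ _) _]ipC
    [ipm _ (grad _ (phase _ _)) _]ipmC in Hpot.
  by rewrite Hpot -Ec -Ee; ring.
have HR' : 2 * Rv z n.+1 * (Rv z n.+1 - Rv z n) = tau * (xi1 p Omega z n.+1 *
    (ip Omega (dGpot p z n.+1) (dphi tau z n.+1) -
     ipm Omega (phiu z n.+1) (grad Omega (chempot z n.+1)) +
     ipm Omega (phigradmu Omega z n.+1) (vel z n.+1))).
  rewrite -[Rv z n.+1 - Rv z n](divfK tau_neq0) HR /xi1 invfM.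
  by move: (Ut _ _ _ _)^-1 => iU; field.
have HQ' : 2 * Qv z n.+1 * (Qv z n.+1 - Qv z n) =
    tau * (- (2 * (Qv z n.+1 ^+ 2 / tfin p)) +
    xi2 p tau z n.+1 * Bform p Omega z n.+1 (vel z n.+1)).
  rewrite -[Qv z n.+1 - Qv z n](divfK tau_neq0) HQ /xi2.
  by move: (expR _) => ex; field.
have Ka2 := ipm_ge0 Omega _ _ (dtau tau (sigmau p z) n.+1).
have Kc2 := ipm_ge0 Omega _ _ (grad Omega (dphi tau z n.+1)).
have Ke2 := ip_ge0 Omega (dphi tau z n.+1).
have := energy_balance_algebra cn0 we0 s0 pe0' rey0' T0' Ka2 Kc2 Ke2 HM HP HR' HQ'.
by rewrite dissipationE !bulk_energyE.
Qed.

Lemma ip_diver_increment n : Xh F (vel z n) -> Xh F (vel z n.+1) ->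
  ip Omega (fun x => diver Omega (vel z n.+1) x - diver Omega (vel z n) x)
           (fun x => diver Omega (vel z n.+1) x - diver Omega (vel z n) x) =
  tau ^+ 2 * ip Omega (diver Omega (dtau tau (vel z) n.+1))
                      (diver Omega (dtau tau (vel z) n.+1)).
Proof.
move=> Xu0 Xu1; have Xdu := dtau_vel_in_space _ Xu0 Xu1.
have L1 := diver_sq_integrable _ oO _ (H1X _ Xu1).
have L0 := diver_sq_integrable _ oO _ (H1X _ Xu0).
have Ld := diver_sq_integrable _ oO _ (H1X _ Xdu).
have Lt := sq_integrableZ _ mO tau _ Ld.
have Lv := sq_integrableB _ mO _ _ L1 L0.
have vE : {ae leb, forall x, Omega x ->
    diver Omega (vel z n.+1) x - diver Omega (vel z n) x =
    tau * diver Omega (dtau tau (vel z) n.+1) x}.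
  have := diver_backward_difference _ oO bO tau _ _ tau_neq0 (H1X _ Xu1)
    (H1X _ Xu0).
  by apply: filterS => x wE Ox; rewrite wE// opprB addrC subrK.
rewrite (eq_ip_ae _ mO _ _ _ Lv Lt Lv vE) ipC.
rewrite (eq_ip_ae _ mO _ _ _ Lv Lt Lt vE).
by rewrite ipZl// ipZr// mulrA.
Qed.

Lemma pressure_pairing n (q : Rd -> R) : eq_pressure p Omega tau z F n ->
  Nh F q ->
  2 * tau * ip Omega q (diver Omega (vel z n)) =
  - (tau ^+ 2 / varrho p * (2 * ip Omega (pres z n - pres z n.-1) q)).
Proof.
move=> Hp Nq; rewrite (Hp q Nq) [ip _ q _]ipC.
have v0 : varrho p != 0 by rewrite gt_eqF// varrho_gt0.
by field; rewrite v0 tau_neq0.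
Qed.

(** In the first step [P# = P0 = P1 - (P1 - P0)]. The pairing telescopes up to
    the square of [P1 - P0], which by the pressure equation is a projection of
    the divergence [D1] of the new velocity. This divergence is not small, but
    [D1^2 <= 2 (D1 - D0)^2 + 2 D0^2], where [D0] comes from the initial data. *)
Lemma pressure_coupling0 : in_spaces 0 -> in_spaces 1 ->
  eq_pressure p Omega tau z F 1 ->
  2 * tau * ip Omega (Psharp z 0) (diver Omega (vel z 1)) <=
  tau ^+ 2 / varrho p *
    (ip Omega (pres z 0) (pres z 0) - ip Omega (pres z 1) (pres z 1)) +
  2 * varrho p * ip Omega (diver Omega (vel z 0)) (diver Omega (vel z 0)) +
  2 * varrho p * (tau ^+ 2 * ip Omega (diver Omega (dtau tau (vel z) 1))
                                      (diver Omega (dtau tau (vel z) 1))).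
Proof.
move=> [_ _ Xu0 Np0] [_ _ Xu1 Np1] Hp.
have Xdu := dtau_vel_in_space _ Xu0 Xu1.
have [Lp0 _] := H1N _ Np0; have [Lp1 _] := H1N _ Np1.
have L1 := diver_sq_integrable _ oO _ (H1X _ Xu1).
have L0 := diver_sq_integrable _ oO _ (H1X _ Xu0).
have Ldp := sq_integrableB _ mO _ _ Lp1 Lp0.
have Ndp : Nh F (pres z 1 - pres z 0) by exact: finite_dimB.
rewrite -ip_diver_increment//.
set P0 := pres z 0 in Lp0 Ldp *; set P1 := pres z 1 in Lp1 Ldp *.
set D0 := diver Omega (vel z 0) in L0 *; set D1 := diver Omega (vel z 1) in L1 *.
have le1 := ip_projection_le _ mO (varrho p / tau) _ _ L1 Ldp (Hp _ Ndp).
have := pressure_pairing _ _ Hp Np0.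
rewrite -/D1 -/P0 /= => ->.
rewrite -[pres z 1 - pres z 0]/(fun x => P1 x - P0 x).
clearbody D0 D1 P0 P1.
have LD := sq_integrableB _ mO _ _ L1 L0.
have L2D0 := sq_integrableZ _ mO 2 _ L0.
have LD2 := sq_integrableB _ mO _ _ L1 L2D0.
(* [2 (D1 - D0)^2 + 2 D0^2 - D1^2] is the square of [D1 - 2 D0] *)
have ge0 := ip_ge0 Omega (fun x => D1 x - 2 * D0 x).
have Edp : ip Omega (fun x => P1 x - P0 x) (fun x => P1 x - P0 x) =
    ip Omega P1 P1 - 2 * ip Omega P1 P0 + ip Omega P0 P0.
  by rewrite ipBl// !ipBr// (ipC Omega P0 P1); ring.
have Ed : ip Omega (fun x => D1 x - D0 x) (fun x => D1 x - D0 x) =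
    ip Omega D1 D1 - 2 * ip Omega D1 D0 + ip Omega D0 D0.
  by rewrite ipBl// !ipBr// (ipC Omega D0 D1); ring.
have Ed2 : ip Omega (fun x => D1 x - 2 * D0 x) (fun x => D1 x - 2 * D0 x) =
    ip Omega D1 D1 - 4 * ip Omega D1 D0 + 4 * ip Omega D0 D0.
  by rewrite ipBl// !ipBr// !ipZl// !ipZr// (ipC Omega D0 D1); ring.
rewrite Ed2 in ge0; rewrite Edp in le1; rewrite Ed ipBl//.
have v0 := varrho_gt0 _ adm.
move: (varrho p) (ip Omega D1 D1) (ip Omega D1 D0) (ip Omega D0 D0)
  (ip Omega P1 P1) (ip Omega P1 P0) (ip Omega P0 P0) v0 le1 ge0
  => v b1 b10 b0 s1 s10 s0 v0 le1 ge0.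
have c0 : 0 < tau ^+ 2 / v by rewrite divr_gt0// exprn_gt0.
have := ler_wpM2l (ltW c0) le1.
have -> : tau ^+ 2 / v * ((v / tau) ^+ 2 * b1) = v * b1.
  by field; rewrite tau_neq0 gt_eqF.
have := mulr_ge0 (ltW v0) ge0.
move: (tau ^+ 2 / v) => c; nra.
Qed.

(** Now [P#] is the new pressure [P2] minus its second difference [e], and
    [2 (P2 - P1, P#) = P2^2 - P1^2 + (P1 - P0)^2 - e^2]. Subtracting two
    consecutive pressure equations shows that [e] is a projection of the
    increment of the divergence. *)
Lemma pressure_coupling n : in_spaces n -> in_spaces n.+1 -> in_spaces n.+2 ->
  eq_pressure p Omega tau z F n.+1 -> eq_pressure p Omega tau z F n.+2 ->
  2 * tau * ip Omega (Psharp z n.+1) (diver Omega (vel z n.+2)) <=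
  tau ^+ 2 / varrho p *
    (ip Omega (pres z n.+1) (pres z n.+1) - ip Omega (pres z n.+2) (pres z n.+2)) +
  varrho p * (tau ^+ 2 * ip Omega (diver Omega (dtau tau (vel z) n.+2))
                                  (diver Omega (dtau tau (vel z) n.+2))).
Proof.
move=> [_ _ _ Np0] [_ _ Xu1 Np1] [_ _ Xu2 Np2] Hp1 Hp2.
have [Lp0 _] := H1N _ Np0; have [Lp1 _] := H1N _ Np1; have [Lp2 _] := H1N _ Np2.
have L1 := diver_sq_integrable _ oO _ (H1X _ Xu1).
have L2 := diver_sq_integrable _ oO _ (H1X _ Xu2).
have Lv := sq_integrableB _ mO _ _ L2 L1.
have Ld10 := sq_integrableB _ mO _ _ Lp1 Lp0.
have Ld21 := sq_integrableB _ mO _ _ Lp2 Lp1.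
have Le := sq_integrableB _ mO _ _ Ld21 Ld10.
have Ne : Nh F ((pres z n.+2 - pres z n.+1) - (pres z n.+1 - pres z n)).
  by do !apply: finite_dimB.
have Nsharp : Nh F (Psharp z n.+1).
  have := finite_dim_lincomb _ _ _ 2 (-1) _ _ finN Np1 Np0.
  by congr (Nh F _); apply/funext => x; rewrite scaleN1r.
rewrite -ip_diver_increment//.
set P0 := pres z n in Lp0 Ld10 Le *.
set P1 := pres z n.+1 in Lp1 Ld10 Ld21 Le *.
set P2 := pres z n.+2 in Lp2 Ld21 Le *.
set D1 := diver Omega (vel z n.+1) in L1 Lv *.
set D2 := diver Omega (vel z n.+2) in L2 Lv *.
set e : Rd -> R := fun x => (P2 x - P1 x) - (P1 x - P0 x) in Le *.
have ee : ip Omega e e =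
    - (varrho p / tau) * ip Omega (fun x => D2 x - D1 x) e.
  rewrite {1}/e ipBl// [in RHS]ipBl// mulrBr; congr (_ - _).
    exact: (Hp2 _ Ne).
  exact: (Hp1 _ Ne).
have le1 := ip_projection_le _ mO (varrho p / tau) _ _ Lv Le ee.
have := pressure_pairing _ _ Hp2 Nsharp.
rewrite -/D2 => ->.
rewrite -[pres z n.+2 - pres z n.+2.-1]/(fun x => P2 x - P1 x).
rewrite -[Psharp z n.+1]/(fun x => 2 * P1 x - P0 x).
clearbody D1 D2 P0 P1 P2.
have L2P1 := sq_integrableZ _ mO 2 _ Lp1.
have Lsharp := sq_integrableB _ mO _ _ L2P1 Lp0.
have ge0 := ip_ge0 Omega (fun x => P1 x - P0 x).
have E10 : ip Omega (fun x => P1 x - P0 x) (fun x => P1 x - P0 x) =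
    ip Omega P1 P1 - 2 * ip Omega P1 P0 + ip Omega P0 P0.
  by rewrite ipBl// !ipBr// (ipC Omega P0 P1); ring.
have Eee : ip Omega e e = ip Omega P2 P2 + 4 * ip Omega P1 P1 + ip Omega P0 P0 -
    4 * ip Omega P2 P1 + 2 * ip Omega P2 P0 - 4 * ip Omega P1 P0.
  rewrite {1}/e ipBl// ipBl// (ipBl _ _ P1 P0)// /e !ipBr//.
  by rewrite (ipC Omega P1 P2) (ipC Omega P0 P2) (ipC Omega P0 P1); ring.
have Es : ip Omega (fun x => P2 x - P1 x) (fun x => 2 * P1 x - P0 x) =
    2 * ip Omega P2 P1 - ip Omega P2 P0 - 2 * ip Omega P1 P1 + ip Omega P1 P0.
  by rewrite ipBl// !ipBr// !ipZr//; ring.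
rewrite Eee in le1; rewrite E10 in ge0; rewrite Es.
have v0 := varrho_gt0 _ adm.
move: (varrho p) (ip Omega (fun x => D2 x - D1 x) (fun x => D2 x - D1 x))
  (ip Omega P2 P2) (ip Omega P2 P1) (ip Omega P2 P0)
  (ip Omega P1 P1) (ip Omega P1 P0) (ip Omega P0 P0) v0 {ee} le1 ge0
  => v b s2 s21 s20 s1 s10 s0 v0 le1 ge0.
have c0 : 0 < tau ^+ 2 / v by rewrite divr_gt0// exprn_gt0.
have := ler_wpM2l (ltW c0) le1.
have -> : tau ^+ 2 / v * ((v / tau) ^+ 2 * b) = v * b.
  by field; rewrite tau_neq0 gt_eqF.
have := mulr_ge0 (ltW c0) ge0.
move: (tau ^+ 2 / v) => c; nra.
Qed.

Lemma energyE n : energy p Omega tau z n =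
  bulk_energy n + tau ^+ 2 / varrho p * ip Omega (pres z n) (pres z n).
Proof. by congr (_ + _ * _); exact: l2norm_sqr. Qed.

Definition unforced_step n := [/\ AC_step p Omega tau z F n,
  forall i, sq_integrable Omega (vcomp (force z n) i) &
  {ae leb, forall x, Omega x -> force z n x = 0}].

Lemma energy_step0 : (forall k, (k <= 1)%N -> in_spaces k) -> unforced_step 1 ->
  energy p Omega tau z 1 + tau * dissipation p Omega z 1 <=
  energy p Omega tau z 0 +
    2 * varrho p * ip Omega (diver Omega (vel z 0)) (diver Omega (vel z 0)).
Proof.
move=> Sp [step Lf f0]; have [_ _ _ [_ Hp] _] := step.
have bal := energy_balance 0 Sp step Lf f0.
have prs := pressure_coupling0 (Sp 0 isT) (Sp 1 isT) Hp.
rewrite !energyE.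
have b0 := mulr_ge0 (sqr_ge0 tau) (ip_ge0 Omega (diver Omega (dtau tau (vel z) 1))).
have [_ _ _ _ z3] := adm; have v0 := varrho_gt0 _ adm.
apply: energy_step_algebra bal prs b0 _; lra.
Qed.

Lemma energy_step n : (forall k, (k <= n.+2)%N -> in_spaces k) ->
  unforced_step n.+1 -> unforced_step n.+2 ->
  energy p Omega tau z n.+2 + tau * dissipation p Omega z n.+2 <=
  energy p Omega tau z n.+1.
Proof.
move=> Sp [[_ _ _ [_ Hp1] _] _ _] [step Lf f0]; have [_ _ _ [_ Hp] _] := step.
have bal := energy_balance n.+1 Sp step Lf f0.
have prs := pressure_coupling n (Sp n (leq_trans (leqnSn _) (leqnSn _)))
  (Sp n.+1 (leqnSn _)) (Sp n.+2 (leqnn _)) Hp1 Hp.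
rewrite !energyE -[leRHS]addr0; rewrite -[X in X + varrho p * _]addr0 in prs.
have b0 := mulr_ge0 (sqr_ge0 tau)
  (ip_ge0 Omega (diver Omega (dtau tau (vel z) n.+2))).
have [_ _ _ _ z3] := adm; have v0 := varrho_gt0 _ adm.
apply: energy_step_algebra bal prs b0 _; lra.
Qed.

Lemma energy_bound N : (forall k, (k <= N.+1)%N -> in_spaces k) ->
  (forall k, (k <= N)%N -> unforced_step k.+1) ->
  energy p Omega tau z N.+1 +
    tau * \sum_(1 <= k < N.+2) dissipation p Omega z k <=
  energy p Omega tau z 0 +
    2 * varrho p * ip Omega (diver Omega (vel z 0)) (diver Omega (vel z 0)).
Proof.
elim: N => [|N IHN] Sp st.
  by rewrite big_nat1; apply: energy_step0 => //; exact: st.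
rewrite big_nat_recr//= mulrDr.
have Sp' k : (k <= N.+1)%N -> in_spaces k by move=> /leqW; exact: Sp.
have st' k : (k <= N)%N -> unforced_step k.+1 by move=> /leqW; exact: st.
apply: le_trans (IHN Sp' st'); rewrite addrA [leRHS]addrC addrAC addrC lerD2l.
by apply: energy_step => //; apply: st.
Qed.

End scheme_energy.

Theorem theorem4 (R : realType) (d : nat) (Omega : set 'rV[R]_d)
    (p : parameters R) (D : initial_data R d) :
  d = 2%N \/ d = 3%N ->
  lipschitz_domain Omega ->
  admissible p ->
  measurable_fun Omega (phi_init D) ->
  (lebesgue_rV d).-integrable Omega (EFin \o (Gpot p \o phi_init D)) ->
  0 < shifted_energy p Omega (phi_init D) ->
  exists C : R,
    forall (kappa C0 : R) (F : fe_spaces R d),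
      0 < kappa -> 0 < C0 ->
      conforming_fe_spaces Omega kappa C0 F ->
      Vh F (phi_h0 D) -> Vh F (mu_h0 D) -> Xh F (u_h0 D) -> Nh F (P_h0 D) ->
    forall (M : nat) (tau : R) (z : trajectory R d),
      (0 < M)%N -> tau = tfin p / M%:R ->
      AC_solution p Omega tau z F D M ->
      (forall n, (n < M)%N -> 0 < shifted_energy p Omega (phase z n)) ->
      (forall n, (n < M)%N -> forall i : 'I_d,
         sq_integrable Omega (vcomp (force z n.+1) i)) ->
      (forall n, (n < M)%N ->
         {ae lebesgue_rV d, forall x, Omega x -> force z n.+1 x = 0}) ->
    forall N : nat, (1 <= N)%N -> N%:R * tau <= tfin p ->
      energy p Omega tau z N +
      tau * \sum_(1 <= k < N.+1) dissipation p Omega z k <= C.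
Proof.
move=> _ [_ oO _ bO _] adm _ _ _.
pose div0 := diver Omega (u_h0 D).
(* the initial energy with [tau] replaced by the final time, and the additional
   cost of the first step *)
exists (l2normm Omega (fun x => sigma p (phi_h0 D x) *: u_h0 D x) ^+ 2 +
  Cn p / We p * l2normm Omega (grad Omega (phi_h0 D)) ^+ 2 +
  stab p / (We p * Cn p) * l2norm Omega (phi_h0 D) ^+ 2 +
  2 / (We p * Cn p) * `|Num.sqrt (shifted_energy p Omega (phi_init D))| ^+ 2 +
  `|1| ^+ 2 + zeta p * l2norm Omega div0 ^+ 2 +
  tfin p ^+ 2 / varrho p * ip Omega (P_h0 D) (P_h0 D) +
  2 * varrho p * ip Omega div0 div0).
move=> kappa C0 F _ _ [_ [finV finX finN] [HV HX HN] _] V0 Vmu0 X0 N0.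
move=> M tau z M0 tauE [[[z0 mu0 u0 p0] [R0 Q0]] steps] _ Lf f0 N N1 NT.
have [_ _ _ T0 _] := adm.
have M0' : 0 < M%:R :> R by rewrite ltr0n.
have tau0 : 0 < tau by rewrite tauE divr_gt0.
have tauT : tau <= tfin p.
  by rewrite tauE ler_pdivrMr// ler_peMr ?ler1n// ltW.
have NM : (N <= M)%N.
  move: NT; rewrite tauE mulrA ler_pdivrMr// mulrC ler_pM2l//.
  by rewrite ler_nat.
have H1V u : Vh F u -> H1 Omega u by move=> /HV[].
have H1X w : Xh F w -> forall i, H1 Omega (vcomp w i).
  by move=> /HX Hw i; have [[]] := Hw i.
have H1N q : Nh F q -> H1 Omega q by move=> /HN[].
have Sp k : (k <= M)%N -> in_spaces F z k.
  case: k => [_|k kM]; last by have [] := steps k kM.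
  by split; rewrite ?z0 ?mu0 ?u0 ?p0.
case: N N1 NM {NT} => // N _ NM.
have Sp' k : (k <= N.+1)%N -> in_spaces F z k.
  by move=> kN; exact: Sp (leq_trans kN NM).
have st k : (k <= N)%N -> unforced_step Omega p F tau z k.+1.
  move=> kN; have kM : (k < M)%N by exact: leq_ltn_trans kN NM.
  by split; [exact: steps|exact: Lf|exact: f0].
have := energy_bound Omega oO bO p adm F finV finX finN H1V H1X H1N tau tau0 z
  N Sp' st.
move=> /le_trans; apply; rewrite energyE /bulk_energy R0 Q0 u0 z0 p0.
rewrite lerD2r; apply: lerD; last first.
  rewrite ler_wpM2r ?ip_ge0// ler_wpM2r ?invr_ge0 ?(ltW (varrho_gt0 _ adm))//.
  by rewrite lerXn2r ?nnegrE// ltW.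
rewrite (_ : sigmau p z 0 = fun x => sigma p (phi_h0 D x) *: u_h0 D x)//.
by apply/funext => x; rewrite /sigmau /sigmat /extrap /= z0 u0.
Qed.
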